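(* Let $X := \left(\mathbb{C}^2 \times (\mathbb{C}^* )^2\right) \cup \left((\mathbb{C}^* )^2 \times \mathbb{C}^2\right)$, an open subset of $\mathbb{C}^4$, with the $\mathbb{C}^*$-action $t \cdot (x_1,x_2,x_3,x_4) := (t x_1, t x_2, x_3, t^{-1} x_4)$. Let $\pi \colon X \to \mathbb{C}^3$ be the morphism $\pi(x_1,x_2,x_3,x_4) := (x_1 x_4, x_2 x_4, x_3)$, and let $Y := \pi(X) \subseteq \mathbb{C}^3$. Then the map $\pi \colon X \to Y$, regarded as a morphism of dc-subsets from $X \subseteq X$ to $Y \subseteq \mathbb{C}^3$, is a categorical quotient for the $\mathbb{C}^*$-action on $X$ in the category of dc-subsets.
   Context: The category of dense constructible subsets (dc-subsets) is defined as follows. Its objects are pairs $X \subseteq X'$, where $X'$ is a complex algebraic variety (varieties are separated, as opposed to prevarieties) and $X$ is a dense constructible subset of $X'$. A morphism from $X \subseteq X'$ to $Y \subseteq Y'$ is a map $X \to Y$ that extends to a morphism of varieties $X_1' \to Y'$ for some open neighbourhood $X_1' \subseteq X'$ of $X$. A variety $X$ is regarded as the dc-subset $X \subseteq X$. Here $\mathbb{C}^* = \mathbb{C} \setminus \{0\}$ is the one-dimensional algebraic torus. A morphism defined on $X$ is called $\mathbb{C}^*$-invariant if it is constant along the $\mathbb{C}^*$-orbits. A categorical quotient for the $\mathbb{C}^*$-action on $X$ in the category of dc-subsets is a $\mathbb{C}^*$-invariant morphism $\pi \colon X \to Y$ of dc-subsets (from $X \subseteq X$ to $Y \subseteq Y'$)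 such that for every dc-subset $Z \subseteq Z'$ and every $\mathbb{C}^*$-invariant morphism $\varphi \colon X \to Z$ of dc-subsets (from $X \subseteq X$ to $Z \subseteq Z'$) there is a unique morphism $\psi \colon Y \to Z$ of dc-subsets (from $Y \subseteq Y'$ to $Z \subseteq Z'$) with $\varphi = \psi \circ \pi$. *)

(* Defs.v *)
From HB Require Import structures.
From mathcomp Require Import all_boot all_order all_algebra.
From mathcomp Require Import complex.
From mathcomp Require Import mpoly.
From mathcomp Require Import boolp classical_sets functions reals topology.

Set Implicit Arguments.
Unset Strict Implicit.
Unset Printing Implicit Defensive.

Import GRing.Theory.
Local Open Scope ring_scope.
Local Open Scope classical_set_scope.

(* A topological space with a sheaf of K-algebras of K-valued functions.  An
   element of O(U) is represented by any total function extending it, so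
   [regular U f] depends only on the restriction of f to U
   ([regular_local] with V := U), and is meaningful only for U open.
   [regular_local] also contains the gluing axiom. *)
Record space_with_functions (K : closedFieldType) := SpaceWithFunctions {
  swf_space :> topologicalType ;
  regular : set swf_space -> (swf_space -> K) -> Prop ;
  regular_local : forall (U : set swf_space) (f : swf_space -> K), open U ->
    (forall x, U x -> exists (V : set swf_space) (g : swf_space -> K),
       [/\ open V, V x, V `<=` U, regular V g &
           forall y, V y -> f y = g y]) ->
    regular U f ;
  regular_restr : forall (U V : set swf_space) (f : swf_space -> K),
    open U -> open V -> V `<=` U -> regular U f -> regular V f ;
  regular_cst : forall (U : set swf_space) (a : K),
    open U -> regular U (fun=> a) ;
  regular_add : forall (U : set swf_space) (f g : swf_space -> K), open U ->
    regular U f -> regular U g -> regular U (fun x => f x + g x) ;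
  regular_mul : forall (U : set swf_space) (f g : swf_space -> K), open U ->
    regular U f -> regular U g -> regular U (fun x => f x * g x)
}.

Arguments regular {K s} U f.

(* The restriction of [f : S -> T] to the open set U is a morphism
   from U (with the induced structure) to T. *)
Definition morphism_on (K : closedFieldType) (S T : space_with_functions K)
    (U : set S) (f : S -> T) : Prop :=
  forall V : set T, open V ->
    open (U `&` f @^-1` V) /\
    forall g : T -> K, regular V g -> regular (U `&` f @^-1` V) (g \o f).

(* f is an isomorphism of S onto an open subspace of T. *)
Definition open_immersion (K : closedFieldType) (S T : space_with_functions K)
    (f : S -> T) : Prop :=
  [/\ injective f,
      open (range f),
      forall W : set S, open W <-> open (f @` W) &
      forall (W : set T) (g : T -> K), open W -> W `<=` range f ->
        regular W g <-> regular (f @^-1` W) (g \o f)].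

Section Zariski.
Variables (K : closedFieldType) (n : nat).

Definition zero_locus (S : set {mpoly K[n]}) : set (n.-tuple K) :=
  [set x | forall p, S p -> p.@[tnth x] = 0].

Definition zariski_closed (A : set (n.-tuple K)) : Prop :=
  exists S : set {mpoly K[n]}, A = zero_locus S.

Variable V : set (n.-tuple K).

Definition zariski : Type := V.
HB.instance Definition _ := Choice.on zariski.

Definition zariski_open : set_system zariski :=
  [set O | exists2 A : set (n.-tuple K), zariski_closed A &
             O = [set x : zariski | ~ A (val x)]].

Lemma zariski_openT : zariski_open setT.
Proof.
exists set0; last by apply/seteqP; split=> // x _ [].
exists [set (1 : {mpoly K[n]})]; apply/seteqP; split=> // x /(_ 1 erefl).
by rewrite meval1 => /eqP; rewrite oner_eq0.
Qed.

Lemma zariski_openI : setI_closed zariski_open.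
Proof.
move=> _ _ [_ [S ->] ->] [_ [T ->] ->].
exists (zero_locus [set r | exists p q, [/\ S p, T q & r = p * q]]).
  by eexists.
apply/seteqP; split=> x /=.
- move=> [nS nT] H; apply: nS => p Sp.
  apply: contrapT => px; apply: nT => q Tq.
  have /eqP := H (p * q) (ex_intro _ p (ex_intro _ q (And3 Sp Tq erefl))).
  by rewrite mevalM mulf_eq0 => /orP[/eqP|/eqP].
- move=> nST; split=> H; apply: nST => _ [p [q [Sp Tq ->]]].
  + by rewrite mevalM (H _ Sp) mul0r.
  + by rewrite mevalM (H _ Tq) mulr0.
Qed.

Lemma zariski_open_bigU (I : Type) (f : I -> set zariski) :
  (forall i, zariski_open (f i)) -> zariski_open (\bigcup_i f i).
Proof.
move=> fo.
exists (zero_locus [set p | exists i S,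
    f i = [set x : zariski | ~ zero_locus S (val x)] /\ S p]).
  by eexists.
apply/seteqP; split=> x /=.
- move=> [i _ fix_] H; have [_ [S ->] fE] := fo i.
  move: fix_; rewrite fE; apply=> p Sp; apply: H; exists i, S; split=> //.
- move=> H; apply: contrapT => nf; apply: H => p [i [S [fE Sp]]].
  apply: contrapT => px; apply: nf; exists i => //; rewrite fE => /= H.
  exact: px (H _ Sp).
Qed.

HB.instance Definition _ := isOpenTopological.Build zariski
  zariski_openT zariski_openI zariski_open_bigU.

(* Functions that are locally quotients of polynomials: for V locally closed,
   these are the regular functions of the (quasi-)affine variety V. *)
Definition zariski_regular (U : set zariski) (f : zariski -> K) : Prop :=
  forall x, U x -> exists (W : set zariski) (p q : {mpoly K[n]}),
    [/\ open W, W x, W `<=` U &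
        forall y : zariski, W y ->
          q.@[tnth (val y)] != 0 /\ f y = p.@[tnth (val y)] / q.@[tnth (val y)]].

Lemma zariski_regular_local (U : set zariski) (f : zariski -> K) : open U ->
  (forall x, U x -> exists (W : set zariski) (g : zariski -> K),
     [/\ open W, W x, W `<=` U, zariski_regular W g &
         forall y, W y -> f y = g y]) ->
  zariski_regular U f.
Proof.
move=> _ H x Ux; have [W [g [oW Wx WU rg fg]]] := H x Ux.
have [W' [p [q [oW' W'x W'W gE]]]] := rg x Wx.
exists W', p, q; split=> // [y /W'W/WU //|y W'y].
by have [qy <-] := gE y W'y; split=> //; apply/fg/W'W.
Qed.

Lemma zariski_regular_restr (U W : set zariski) (f : zariski -> K) :
  open U -> open W -> W `<=` U -> zariski_regular U f -> zariski_regular W f.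
Proof.
move=> _ oW WU rf x Wx; have [W' [p [q [oW' W'x _ fE]]]] := rf x (WU x Wx).
exists (W' `&` W), p, q; split; [exact: openI|by []|by move=> y []|].
by move=> y [W'y _]; exact: fE.
Qed.

Lemma zariski_regular_cst (U : set zariski) (a : K) :
  open U -> zariski_regular U (fun=> a).
Proof.
move=> oU x Ux; exists U, a%:MP, 1; split=> // y _.
by rewrite mevalC meval1 oner_neq0 divr1.
Qed.

Lemma zariski_regular_add (U : set zariski) (f g : zariski -> K) : open U ->
  zariski_regular U f -> zariski_regular U g ->
  zariski_regular U (fun x => f x + g x).
Proof.
move=> _ rf rg x Ux.
have [W [p [q [oW Wx WU fE]]]] := rf x Ux.
have [W' [p' [q' [oW' W'x _ gE]]]] := rg x Ux.
exists (W `&` W'), (p * q' + p' * q), (q * q').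
split; [exact: openI|by []|by move=> y [/WU]|] => y [Wy W'y].
have [qy ->] := fE y Wy; have [q'y ->] := gE y W'y.
by rewrite mevalD !mevalM mulf_neq0 // addf_div.
Qed.

Lemma zariski_regular_mul (U : set zariski) (f g : zariski -> K) : open U ->
  zariski_regular U f -> zariski_regular U g ->
  zariski_regular U (fun x => f x * g x).
Proof.
move=> _ rf rg x Ux.
have [W [p [q [oW Wx WU fE]]]] := rf x Ux.
have [W' [p' [q' [oW' W'x _ gE]]]] := rg x Ux.
exists (W `&` W'), (p * p'), (q * q').
split; [exact: openI|by []|by move=> y [/WU]|] => y [Wy W'y].
have [qy ->] := fE y Wy; have [q'y ->] := gE y W'y.
by rewrite !mevalM mulf_neq0 // mulf_div.
Qed.

Definition zariski_space : space_with_functions K :=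
  @SpaceWithFunctions K zariski zariski_regular
    zariski_regular_local zariski_regular_restr zariski_regular_cst
    zariski_regular_add zariski_regular_mul.

End Zariski.

Definition affine_space (K : closedFieldType) (n : nat) :
  space_with_functions K := zariski_space [set: n.-tuple K].

Definition affine_chart (K : closedFieldType) (X : space_with_functions K)
    (n : nat) (V : set (n.-tuple K)) (c : zariski_space V -> X) : Prop :=
  zariski_closed V /\ open_immersion c.

Definition affine_open (K : closedFieldType) (X : space_with_functions K)
    (U : set X) : Prop :=
  exists (n : nat) (V : set (n.-tuple K)) (c : zariski_space V -> X),
    affine_chart c /\ range c = U.

(* Not necessarily irreducible. *)
Definition is_prevariety (K : closedFieldType) (X : space_with_functions K) :
    Prop :=
  exists (N : nat) (U : 'I_N -> set X),
    (forall i, affine_open (U i)) /\ \bigcup_i U i = [set: X].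

(* Closed subsets of the product prevariety X x Y, which is covered by the
   open subsets V x W, for V and W affine charts of X and Y; if V and W are
   closed in K^n and K^m, then V x W is closed in K^(n+m). *)
Definition product_closed (K : closedFieldType) (X Y : space_with_functions K)
    (A : set (X * Y)) : Prop :=
  forall (n m : nat) (V : set (n.-tuple K)) (W : set (m.-tuple K))
         (c : zariski_space V -> X) (d : zariski_space W -> Y),
    affine_chart c -> affine_chart d ->
    zariski_closed [set u : (n + m).-tuple K |
      exists (v : zariski_space V) (w : zariski_space W),
        u = [tuple of val v ++ val w] /\ A (c v, d w)].

Definition is_separated (K : closedFieldType) (X : space_with_functions K) :
    Prop := product_closed [set p : X * X | p.1 = p.2].

Definition is_variety (K : closedFieldType) (X : space_with_functions K) :
    Prop := is_prevariety X /\ is_separated X.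

Definition constructible (T : topologicalType) (A : set T) : Prop :=
  exists (N : nat) (U F : 'I_N -> set T),
    [/\ forall i, open (U i), forall i, closed (F i) &
        A = \bigcup_i (U i `&` F i)].

Definition is_dc_subset (K : closedFieldType) (X' : space_with_functions K)
    (X : set X') : Prop :=
  [/\ is_variety X', dense X & constructible X].

(* The extension is a morphism on the open neighbourhood U only.  Taking it as
   a total function is harmless: if X' is nonempty then so is the dense subset
   X, hence so is Y'. *)
Definition is_dc_morphism (K : closedFieldType)
    (X' Y' : space_with_functions K) (X : set X') (Y : set Y') (f : X -> Y) :
    Prop :=
  exists (U : set X') (F : X' -> Y'),
    [/\ open U, X `<=` U, morphism_on U F &
        forall x : X, F (val x) = val (f x)].

(* The variety X is the dc-subset [set: X] of itself; the [val]s go from the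
   subtype [set: X] to X. *)
Definition is_invariant (K : closedFieldType) (X : space_with_functions K)
    (G T : Type) (act : G -> X -> X) (f : [set: X] -> T) : Prop :=
  forall (t : G) (x y : [set: X]), val y = act t (val x) -> f y = f x.

Definition is_dc_categorical_quotient (K : closedFieldType)
    (X : space_with_functions K) (G : Type) (act : G -> X -> X)
    (Y' : space_with_functions K) (Y : set Y') (pi : [set: X] -> Y) : Prop :=
  [/\ is_dc_subset [set: X],
      is_dc_subset Y,
      is_dc_morphism pi,
      is_invariant act pi &
      forall (Z' : space_with_functions K) (Z : set Z') (phi : [set: X] -> Z),
        is_dc_subset Z -> is_dc_morphism phi -> is_invariant act phi ->
        exists! psi : Y -> Z, is_dc_morphism psi /\ phi = psi \o pi].

Section Example.
Variable R : realType.
Local Notation C := (R[i]).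

Definition exX_set : set (4.-tuple C) :=
  [set x : 4.-tuple C | (x`_2 != 0 /\ x`_3 != 0) \/ (x`_0 != 0 /\ x`_1 != 0)].

Definition exX : space_with_functions C := zariski_space exX_set.

Definition Cstar : Type := {t : C | t != 0}.

Definition ex_act_fun (t : C) (x : 4.-tuple C) : 4.-tuple C :=
  [tuple t * x`_0; t * x`_1; x`_2; t^-1 * x`_3].

Lemma ex_act_subproof (t : Cstar) (x : exX) :
  ex_act_fun (val t) (val x) \in exX_set.
Proof.
case: t => t t0; case: x => x /= /set_mem xX; apply/mem_set; rewrite /exX_set /=.
by case: xX => -[? ?]; [left|right]; rewrite !mulf_neq0 ?invr_neq0.
Qed.

Definition ex_act (t : Cstar) (x : exX) : exX :=
  exist _ (ex_act_fun (val t) (val x)) (ex_act_subproof t x).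

Definition ex_pi_fun (x : exX) : affine_space C 3 :=
  let x := val x in
  exist _ [tuple x`_0 * x`_3; x`_1 * x`_3; x`_2] (in_setT _).

Definition exY : set (affine_space C 3) := range ex_pi_fun.

Definition ex_pi (x : [set: exX]) : exY :=
  exist _ (ex_pi_fun (val x)) (mem_set (imageT ex_pi_fun (val x))).

End Example.

(* Main.v *)
Require Import Defs.
From HB Require Import structures.
From mathcomp Require Import all_boot all_order all_algebra.
From mathcomp Require Import mpoly.
From mathcomp Require Import boolp classical_sets functions reals topology.
From mathcomp Require Import complex.
From mathcomp Require Import ring.

(** Since [pi] maps onto Y, [psi] is unique and only its existence matters.
    Let [phi] be invariant.  Off the origin of Y, [pi] has the section
    [y |-> (y1, y2, y3, 1)], and separatedness of Z' forces [phi] to be constant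
    on the fibres of [pi]: for [x3 != 0] the limit of [phi (a, b, x3, x4)] at
    [x4 = 0] is [phi (0, 0, x3, 1)], so that [phi (a, b, x3, 0)] does not depend
    on [(a, b)], and by continuity this remains true at [x3 = 0].  Hence
    [psi = phi o section] off the origin.

    At the origin, let [f] be a coordinate of an affine chart of Z' around
    [phi (1, 1, 0, 0)], write [f o section = p / q] in lowest terms and
    [f o phi = P / Q] near [(1, 1, 0, 0)].  On the slice [x1 = 1], [pi] is the
    blow-up chart [(s, u, c) |-> (s, u s, c)], where [P * q = Q * p].  As p and q
    are coprime, q divides Q up to a power of s; as [f o section] is defined at
    the generic point of the line [y1 = y2 = 0], s does not divide q.  Therefore
    q divides Q on the slice and [q 0 != 0], so [psi] extends regularly to a
    neighbourhood of the origin. *)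

Set Implicit Arguments.
Unset Strict Implicit.
Unset Printing Implicit Defensive.

Import GRing.Theory.
Local Open Scope ring_scope.

(** * Polynomial rings over a field are GCD domains *)

Definition divides (R : idomainType) (d z : R) : Prop := exists w, z = w * d.

(** The last clause says that [z * a'] and [z * b'] have gcd [z] for every [z]. This strong form of
    coprimality contains Euclid's lemma: take [d = a']. *)
Definition gcd_domain (R : idomainType) : Prop := forall a b : R,
  exists g a' b', [/\ a = g * a', b = g * b' &
    forall d z, divides d (z * a') -> divides d (z * b') -> divides d z].

Section Gauss.
Variable R : idomainType.
Implicit Types (p q : {poly R}) (d z lam : R).

Lemma divides_trans (a b c : R) : divides a b -> divides b c -> divides a c.
Proof. by move=> [u ->] [v ->]; exists (v * u); rewrite mulrA. Qed.

Lemma divides_mull (a b c : R) : divides a b -> divides a (c * b).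
Proof. by move=> [u ->]; exists (c * u); rewrite mulrA. Qed.

Lemma scale_polyI (c : R) : c != 0 -> injective (fun p => c *: p).
Proof. by move=> c0 p q; rewrite -!mul_polyC; apply: mulfI; rewrite polyC_eq0. Qed.

Definition coef_divides d p := forall i, divides d p`_i.

Lemma coef_dividesP d p : coef_divides d p <-> exists q, p = d *: q.
Proof.
split=> [H|[q ->] i]; last by rewrite coefZ; exists q`_i; rewrite mulrC.
have /choice[f fP] := H.
exists (\poly_(i < size p) f i); apply/polyP => i.
rewrite coefZ coef_poly; case: ltnP => [_|]; first by rewrite [LHS]fP mulrC.
by move=> /leq_sizeP/(_ i (leqnn _)) ->; rewrite mulr0.
Qed.

(** Content 1, in the same strong form as in [gcd_domain]: the coefficients of [z *: p] have gcd
    [z]. *)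
Definition primitive p :=
  forall d z, coef_divides d (z *: p) -> divides d z.

Definition coef_coprime lam p := forall d z,
  divides d (z * lam) -> coef_divides d (z *: p) -> divides d z.

Hypothesis gcdR : gcd_domain R.

(** The content is accumulated by Horner induction: take the gcd of the new constant term with the
    content of the higher coefficients. *)
Lemma primitive_part p : exists g p', p = g *: p' /\ primitive p'.
Proof.
elim/poly_ind: p => [|p c [g [p' [-> prim]]]].
  exists 0, 1; rewrite scale0r; split=> // d z /(_ 0%N).
  by rewrite coefZ coef1 mulr1.
have [h [c' [g' [-> -> cop]]]] := gcdR c g.
exists h, (g' *: p' * 'X + c'%:P); split.
  by rewrite scalerDr -!mul_polyC polyCM; ring.
move=> d z H; apply: cop.
  by have := H 0%N; rewrite coefZ coefD coefC coefMX add0r.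
apply: prim => i; have := H i.+1.
by rewrite coefZ coefD coefC coefMX addr0 /= !coefZ mulrA.
Qed.

Lemma coef_gcd lam p : exists g lam' p',
  [/\ lam = g * lam', p = g *: p' & coef_coprime lam' p'].
Proof.
have [c [p1 [-> prim]]] := primitive_part p.
have [g [lam' [c' [-> -> cop]]]] := gcdR lam c.
exists g, lam', (c' *: p1); split=> //; first by rewrite scalerA.
by move=> d z d1 d2; apply: cop => //; apply: prim => i; rewrite -scalerA; apply: d2.
Qed.

Lemma coef_coprime_dvd lam mu p : divides mu lam -> coef_coprime lam p ->
  coef_coprime mu p.
Proof.
by move=> [w ->] H d z d1 d2; apply: H => //; rewrite mulrCA; apply: divides_mull.
Qed.

Let drop_lead p : {poly R} := p - lead_coef p *: 'X^((size p).-1).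

Lemma size_drop_lead p : p != 0 -> (size (drop_lead p) < size p)%N.
Proof.
move=> p0; have sp : (0 < size p)%N by rewrite size_poly_gt0.
rewrite -(prednK sp) ltnS; apply/leq_sizeP => j hj.
rewrite coefB coefZ coefXn lead_coefE.
case: eqVneq => [->|ne]; first by rewrite mulr1 subrr.
rewrite mulr0 subr0 nth_default // -(prednK sp).
by rewrite ltn_neqAle eq_sym ne.
Qed.

(** Induction step of [coef_divides_prod], applied there to each of the two factors: [lam] is
    coprime even to the leading coefficient. *)
Lemma lead_coef_coprime lam p q : p != 0 ->
  (forall mu, coef_divides mu (drop_lead p * q) ->
     coef_coprime mu (drop_lead p) -> coef_coprime mu q -> divides mu 1) ->
  coef_divides lam (p * q) -> coef_coprime lam p -> coef_coprime lam q ->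
  forall d z, divides d (z * lam) -> divides d (z * lead_coef p) -> divides d z.
Proof.
move=> p0 IH lpq cp cq d z d1 d2.
have [g [lam' [a [El Ea cop]]]] := gcdR lam (lead_coef p).
have gl : divides g lam by exists lam'; rewrite mulrC.
(* [g] divides the coefficients of [p * q] and the leading coefficient of [p], hence the
   coefficients of [drop_lead p * q]. A common divisor of [g] and [drop_lead p] divides [lam] and
   all of [p]. So the induction hypothesis makes [g] a unit. *)
have [w g1] : divides g 1.
  apply: IH.
  - move=> i; rewrite mulrBl coefB.
    have [u ->] := divides_trans gl (lpq i).
    exists (u - a * ('X^((size p).-1) * q)`_i).
    rewrite -scalerAl coefZ Ea; by rewrite mulrBl [a * _ * g]mulrAC (mulrC a).
  - move=> e y e1 e2; apply: cp; first by rewrite El mulrA mulrC; apply: divides_mull.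
    move=> i; rewrite -[p](subrK (lead_coef p *: 'X^((size p).-1))) scalerDr coefD.
    have [u ->] := e2 i; have [v Ev] := e1.
    exists (u + v * a * ('X^((size p).-1))`_i).
    by rewrite !coefZ Ea mulrDl; congr (_ + _); rewrite !mulrA Ev; ring.
  - exact: coef_coprime_dvd cq.
have ue (b c : R) : divides d (z * (b * c)) -> b = g -> divides d (z * c).
  move=> /(divides_mull w) H Eb; move: H.
  by rewrite Eb; have -> : w * (z * (g * c)) = (w * g) * (z * c);
    [ring|rewrite -g1 mul1r].
by apply: cop; [move: d1; rewrite El|move: d2; rewrite Ea] => /ue; apply.
Qed.

(** Induction on the total size: [lam] is coprime to both leading coefficients, yet divides their
    product, so it is a unit. *)
Lemma coef_divides_prod lam p q : coef_divides lam (p * q) ->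
  coef_coprime lam p -> coef_coprime lam q -> divides lam 1.
Proof.
have [n] := ubnP (size p + size q); elim: n => // n IH in lam p q *.
rewrite ltnS => spq lpq cp cq.
have z0 r : r = 0 -> coef_coprime lam r -> divides lam 1.
  move=> -> cr; apply: cr; first by exists 1; ring.
  by move=> i; rewrite scaler0 coef0; exists 0; ring.
have [/z0|p0] := eqVneq p 0; first exact.
have [/z0|q0] := eqVneq q 0; first exact.
have copp : forall d z, divides d (z * lam) -> divides d (z * lead_coef p) ->
  divides d z.
  apply: (lead_coef_coprime (q := q)) => // mu h1 h2 h3; apply: IH h1 h2 h3.
  by apply: leq_trans spq; rewrite ltn_add2r size_drop_lead.
have copq : forall d z, divides d (z * lam) -> divides d (z * lead_coef q) ->
  divides d z.
  apply: (lead_coef_coprime (q := p)) => //; last by rewrite mulrC.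
  move=> mu h1 h2 h3; apply: (IH _ (drop_lead q) p) h1 h2 h3.
  by apply: leq_trans spq; rewrite addnC ltn_add2l size_drop_lead.
apply: copq; first by exists 1; ring.
rewrite mul1r; apply: copp; first by exists (lead_coef q); ring.
by rewrite mulrC -lead_coefM lead_coefE; apply: lpq.
Qed.

(** Cancel from [lam] and [q] the gcd of [lam] with the coefficients of [q]. What is left of [lam]
    divides [q' * p] and is coprime to both factors, so it is a unit. *)
Lemma gauss_lemma lam p q : lam != 0 -> primitive p -> coef_divides lam (q * p) ->
  coef_divides lam q.
Proof.
move=> l0 prim lqp.
have [g [lam' [q' [El Eq cop]]]] := coef_gcd lam q.
have g0 : g != 0 by move: l0; rewrite El mulf_eq0 negb_or => /andP[].
have [w w1] : divides lam' 1.
  apply: (@coef_divides_prod _ p q') => //; last first.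
    by move=> d z _; apply: prim.
  move=> i; have [u] := lqp i; rewrite Eq El -scalerAl coefZ mulrCA => /(mulfI g0) E.
  by exists u; rewrite mulrC.
apply/coef_dividesP; exists (w *: q').
by rewrite Eq El scalerA mulrAC -mulrA -w1 mulr1.
Qed.

(* Take a pair of minimal degree among those proportional to [(a, b)]: pseudo-division
   by it leaves remainder 0.  Adding [a'] and a shift of [b'] merges their contents. *)
Lemma minimal_pair (a b : {poly R}) : b != 0 -> exists a' b' : {poly R},
  [/\ b' != 0, a * b' = b * a',
      primitive (a' + 'X^(size a') * b') &
      forall u v, u * b' = v * a' ->
        exists lam q, [/\ lam != 0, lam *: u = q * a' & lam *: v = q * b']].
Proof.
move=> b0.
pose P n := `[< exists a' b', [/\ b' != 0, a * b' = b * a' & size b' = n] >].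
have exP : exists n, P n by exists (size b); apply/asboolP; exists a, b; rewrite mulrC.
case: (ex_minnP exP) => n /asboolP[a1 [b1 [b10 ab1 sb1]]] minn.
have [g [r [Er prim]]] := primitive_part (a1 + 'X^(size a1) * b1).
have cr i : (r)`_i * g = (a1 + 'X^(size a1) * b1)`_i by rewrite Er coefZ mulrC.
have g0 : g != 0.
  apply: contra_neq b10 => g0.
  apply/polyP => i; have := cr (size a1 + i)%N.
  rewrite g0 mulr0 coefD nth_default ?leq_addr // coefXnM ltnNge leq_addr /=.
  by rewrite addKn add0r => <-; rewrite coef0.
have [a' Ea] : exists q, a1 = g *: q.
  apply/coef_dividesP => i; exists (if (i < size a1)%N then r`_i else 0).
  case: ltnP => hi; last by rewrite nth_default ?mul0r.
  by rewrite cr coefD coefXnM hi addr0.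
have [b' Eb] : exists q, b1 = g *: q.
  apply/coef_dividesP => i; exists (r`_(size a1 + i)).
  rewrite cr coefD [a1`_ _]nth_default ?leq_addr // coefXnM ltnNge leq_addr /=.
  by rewrite addKn add0r.
have E0 : a * b' = b * a'.
  apply: (scale_polyI g0); rewrite !scalerAr -Ea -Eb //.
have sg (x : {poly R}) : size (g *: x) = size x by rewrite size_scale.
have b'0 : b' != 0 by apply: contra_neq b10 => E; rewrite Eb E scaler0.
exists a', b'; split=> //.
  suff -> : a' + 'X^(size a') * b' = r by [].
  by apply: (scale_polyI g0); rewrite -Er scalerDr scalerAr -Ea -Eb Ea sg.
move=> u v Euv.
have l0 : lead_coef b' ^+ scalp v b' != 0 by rewrite expf_neq0 ?lead_coef_eq0.
have := Pdiv.Idomain.divp_eq v b'; set k := _ ^+ _ in l0 *; set q := v %/ b' => Ev.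
have Er' : a' * (v %% b') = b' * (k *: u - q * a').
  have -> : v %% b' = k *: v - q * b' by rewrite Ev addrC addKr.
  rewrite !mulrBr -!scalerAr (mulrC b' u) Euv mulrC; congr (_ *: _ - _); ring.
have [r0|r0] := eqVneq (v %% b') 0; last first.
  suff /minn : P (size (v %% b')).
    by rewrite -sb1 Eb sg leqNgt ltn_modp b'0.
  apply/asboolP; exists (k *: u - q * a'), (v %% b'); split=> //.
  by apply: (mulfI b'0); rewrite [RHS]mulrCA -Er' mulrA (mulrC b') E0 mulrA.
exists k, q; split=> //; last by rewrite Ev r0 addr0.
move/eqP: Er'; rewrite r0 mulr0 eq_sym mulf_eq0 (negPf b'0) subr_eq0.
by move/eqP.
Qed.

Lemma gcd_domain_poly : gcd_domain {poly R}.
Proof.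
move=> a b; have [->|b0] := eqVneq b 0.
  exists a, 1, 0; rewrite mulr1 mulr0; split=> // d z.
  by rewrite mulr1.
have [a' [b' [b'0 E prim gen]]] := minimal_pair a b0.
(* Every pair proportional to [(a', b')] is a polynomial multiple of it: the factor [lam] given by
   [gen] divides [q] by Gauss's lemma, since [a' + 'X^(size a') * b'] is primitive. *)
have prop u v : u * b' = v * a' -> exists g, u = g * a' /\ v = g * b'.
  move=> /gen[lam [q [l0 Eu Ev]]].
  have /coef_dividesP[g Eg] : coef_divides lam q.
    apply: (gauss_lemma l0 prim); apply/coef_dividesP; exists (u + 'X^(size a') * v).
    by rewrite mulrDr mulrCA scalerDr scalerAr -Eu -Ev -scalerAr.
  exists g; split; apply: (scale_polyI l0); rewrite scalerAl -Eg //.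
have [g [-> ->]] := prop _ _ E.
exists g, a', b'; split=> // d z.
have [->|d0] := eqVneq d 0.
  move=> _ [w]; rewrite mulr0 => /eqP; rewrite mulf_eq0 (negPf b'0) orbF => /eqP ->.
  by exists 0; rewrite mulr0.
(* The quotients of [z * a'] and [z * b'] by [d] are again proportional to [(a', b')]; their common
   multiplier is the quotient of [z] by [d]. *)
move=> [u Eu] [v Ev].
have [h [_ Eh]] : exists g, u = g * a' /\ v = g * b'.
  apply: prop; apply: (mulIf d0).
  by rewrite mulrAC -Eu [RHS]mulrAC -Ev; ring.
by exists h; apply: (mulIf b'0); rewrite Ev Eh; ring.
Qed.

End Gauss.

(** * Transfer to polynomials in several variables *)

Lemma mpoly_gen_ind (R : comNzRingType) n (P : {mpoly R[n]} -> Prop) :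
  (forall c, P c%:MP) -> (forall i, P 'X_i) ->
  (forall p q, P p -> P q -> P (p + q)) ->
  (forall p q, P p -> P q -> P (p * q)) ->
  forall p, P p.
Proof.
move=> PC PX PD PM; elim/mpolyind => [|c m p _ _ Pp]; first by rewrite -mpolyC0.
apply: (PD) => //; rewrite -mul_mpolyC; apply: (PM) => //.
rewrite mpolyXE_id; elim/big_ind: _ => [|p1 q1|i _]; [exact: PC|exact: PM|].
by elim: (m i) => [|k IH]; [exact: PC|rewrite exprS; apply: (PM)].
Qed.

Section MPolyLast.
Variables (R : comNzRingType) (n : nat).

Lemma muniX_widen (i : 'I_n) : muni 'X_(widen_ord (leqnSn n) i) = ('X_i)%:P :>
  {poly {mpoly R[n]}}.
Proof.
rewrite /muni mmapX mmap1U; case: splitP => [j /= E|k /= E].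
  by congr ('X__)%:P; apply/val_inj.
by have := ltn_ord i; rewrite E ltnNge leq_addr.
Qed.

Lemma muniX_max : muni 'X_ord_max = 'X :> {poly {mpoly R[n]}}.
Proof.
rewrite /muni mmapX mmap1U; case: splitP => [j /= E|//].
by have := ltn_ord j; rewrite -E ltnn.
Qed.

Lemma ord_max_or_widen (i : 'I_n.+1) :
  i = ord_max \/ exists j : 'I_n, i = widen_ord (leqnSn n) j.
Proof.
case: (eqVneq i ord_max) => [->|ne]; [by left|right].
have lt_in : (i < n)%N.
  by rewrite ltn_neqAle -ltnS ltn_ord andbT; apply: contra_neq ne => E; apply/val_inj.
by exists (Ordinal lt_in); apply/val_inj.
Qed.

Lemma muni_add (p q : {mpoly R[n.+1]}) : muni (p + q) = muni p + muni q.
Proof. exact: muniD. Qed.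

Lemma muni_mul (p q : {mpoly R[n.+1]}) : muni (p * q) = muni p * muni q.
Proof. exact: muniM. Qed.

Definition muni_inv (p : {poly {mpoly R[n]}}) : {mpoly R[n.+1]} :=
  (map_poly (@mwiden n R) p).['X_ord_max].

Lemma mwidenXU (i : 'I_n) : mwiden 'X_i = 'X_(widen_ord (leqnSn n) i) :> {mpoly
  R[n.+1]}.
Proof. by rewrite mwidenX mnmwiden1. Qed.

Lemma muni_mwiden (p : {mpoly R[n]}) : muni (mwiden p) = p%:P.
Proof.
elim/mpoly_gen_ind: p => [c|i|p q Ep Eq|p q Ep Eq].
- by rewrite mwidenC muniC.
- by rewrite mwidenXU muniX_widen.
- by rewrite mwidenD muniD Ep Eq polyCD.
- by rewrite mwidenM muniM Ep Eq polyCM.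
Qed.

Lemma muni_invM p q : muni_inv (p * q) = muni_inv p * muni_inv q.
Proof. by rewrite /muni_inv rmorphM hornerM. Qed.

Lemma muni_invD p q : muni_inv (p + q) = muni_inv p + muni_inv q.
Proof. by rewrite /muni_inv rmorphD hornerD. Qed.

Lemma muni_invC (p : {mpoly R[n]}) : muni_inv p%:P = mwiden p.
Proof. by rewrite /muni_inv map_polyC hornerC. Qed.

Lemma muni_invX : muni_inv 'X = 'X_ord_max.
Proof. by rewrite /muni_inv map_polyX hornerX. Qed.

Lemma muniK : cancel (@muni n R) muni_inv.
Proof.
elim/mpoly_gen_ind => [c|i|p q Ep Eq|p q Ep Eq].
- by rewrite muniC muni_invC mwidenC.
- have [->|[j ->]] := ord_max_or_widen i; first by rewrite muniX_max muni_invX.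
  by rewrite muniX_widen muni_invC mwidenXU.
- by rewrite muni_add muni_invD; congr (_ + _).
- by rewrite muni_mul muni_invM; congr (_ * _).
Qed.

Lemma muni_invK : cancel muni_inv (@muni n R).
Proof.
elim/poly_ind => [|p c Ep]; first by rewrite /muni_inv rmorph0 horner0 muni0.
by rewrite muni_invD muni_invM muni_invX muni_invC muni_add muni_mul Ep muniX_max
  muni_mwiden.
Qed.

Lemma map_muni (f : {rmorphism {mpoly R[n]} -> R}) (v : 'I_n.+1 -> R) p :
  (forall c, f c%:MP = c) -> (forall j, f 'X_j = v (widen_ord (leqnSn n) j)) ->
  (map_poly f (muni p)).[v ord_max] = p.@[v].
Proof.
move=> fC fX; elim/mpoly_gen_ind: p => [c|i|p q Ep Eq|p q Ep Eq].
- by rewrite muniC map_polyC hornerC /= mevalC fC.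
- have [->|[j ->]] := ord_max_or_widen i.
    by rewrite muniX_max map_polyX hornerX mevalXU.
  by rewrite muniX_widen map_polyC hornerC /= mevalXU fX.
- by rewrite muni_add mevalD -Ep -Eq [X in X.[_]]rmorphD hornerD.
- by rewrite muni_mul mevalM -Ep -Eq [X in X.[_]]rmorphM hornerM.
Qed.

End MPolyLast.

Lemma gcd_domain_iso (R S : idomainType) (f : R -> S) (g : S -> R) :
  {morph f : x y / x * y} -> {morph g : x y / x * y} ->
  cancel f g -> cancel g f -> gcd_domain S -> gcd_domain R.
Proof.
move=> fM gM fK gK G a b; have [h [a' [b' [Ea Eb cop]]]] := G (f a) (f b).
exists (g h), (g a'), (g b'); split.
- by rewrite -gM -Ea fK.
- by rewrite -gM -Eb fK.
move=> d z [u Eu] [v Ev].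
have [||w Ew] := cop (f d) (f z).
- by exists (f u); rewrite -fM -Eu fM gK.
- by exists (f v); rewrite -fM -Ev fM gK.
by exists (g w); apply: (can_inj fK); rewrite Ew fM gK.
Qed.

(** Base case of the induction on the number of variables, where all polynomials are constant and
    the nonzero ones are units. *)
Lemma gcd_domain_units (R : idomainType) :
  (forall a : R, a != 0 -> divides a 1) -> gcd_domain R.
Proof.
move=> U a b.
suff H c e : c != 0 -> exists g c' e' : R, [/\ c = g * c', e = g * e' &
    forall d z, divides d (z * c') -> divides d z].
  have [a0|/(H _ b)[g [a' [b' [? ? c]]]]] := eqVneq a 0.
    have [b0|/(H _ a)[g [b' [a' [? ? c]]]]] := eqVneq b 0.
      exists 0, 1, 1; rewrite a0 b0 mulr1; split=> // d z; by rewrite mulr1.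
    by exists g, a', b'; split=> // d z _; apply: c.
  by exists g, a', b'; split=> // d z dz _; apply: c dz.
move=> c0; exists c, 1; have [w w1] := U _ c0; exists (w * e).
by split; rewrite ?mulr1 // ?mulrA ?(mulrC c) -?w1 ?mul1r // => d z; rewrite mulr1.
Qed.

Lemma mpoly0_const (R : comNzRingType) (p : {mpoly R[0]}) : exists c, p = c%:MP.
Proof.
elim/mpoly_gen_ind: p => [c|[]//|p q [c ->] [d ->]|p q [c ->] [d ->]].
- by exists c.
- by exists (c + d); rewrite mpolyCD.
- by exists (c * d); rewrite mpolyCM.
Qed.

Lemma gcd_domain_mpoly (K : fieldType) n : gcd_domain {mpoly K[n]}.
Proof.
elim: n => [|n IH].
  apply: gcd_domain_units => a.
  have [c ->] := mpoly0_const a => c0; exists (c^-1)%:MP; rewrite -mpolyCM mulVf //.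
  by apply: contra_neq c0 => ->.
apply: (gcd_domain_iso (@muniM n K) (@muni_invM K n) (@muniK K n) (@muni_invK K n)).
exact: gcd_domain_poly.
Qed.

(** * Nonvanishing of polynomials over a closed field *)

Section ClosedField.
Variable K : closedFieldType.

(** At a root [x] of the nonconstant polynomial [1 + p * 'X], the product [p.[x] * x] is [-1]. *)
Lemma poly_nonroot (p : {poly K}) : p != 0 -> exists x, p.[x] != 0.
Proof.
move=> p0; have /closed_rootP[x] : size (1 + p * 'X) != 1%N.
  by rewrite addrC size_polyDl ?size_mulX // ?size_poly1 ?ltnS ?size_poly_gt0 //
    eqSS size_poly_eq0.
rewrite rootE !hornerE addrC => H; exists x.
by apply: contraTneq H => ->; rewrite mul0r add0r oner_neq0.
Qed.

Lemma mpoly_nonroot n (p : {mpoly K[n]}) : p != 0 ->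
  exists x : n.-tuple K, p.@[tnth x] != 0.
Proof.
move=> p0; suff [v pv] : exists v, p.@[v] != 0.
  exists [tuple v i | i < n]; rewrite (meval_eq (v2 := v)) // => i.
  by rewrite tnth_mktuple.
elim: n p p0 => [|n IH] p p0.
  have [c Ec] := mpoly0_const p; exists (fun=> 0); rewrite Ec mevalC.
  by apply: contra_neq p0 => c0; rewrite Ec c0 mpolyC0.
(* First choose the other variables off the zeros of the leading coefficient in the last variable,
   then the last variable off the roots. *)
have /IH[v] : lead_coef (muni p) != 0.
  by rewrite lead_coef_eq0; apply: contra_neq p0 => E;
    rewrite -[p]muniK E /muni_inv rmorph0 horner0.
rewrite lead_coefE => v0.
have /poly_nonroot[y] : map_poly (meval v) (muni p) != 0.
  apply: contra_neq v0 => E; rewrite -[LHS](coef_map (meval v)) E coef0 //.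
move=> y0; pose w (i : 'I_n.+1) := if insub (val i) is Some j then v j else y.
have wm : w ord_max = y by rewrite /w insubF ?ltnn.
exists w; rewrite -(map_muni p (f := meval v)) ?wm //; first exact: mevalC.
move=> j; rewrite [LHS]mevalXU /w insubT //= => h.
by congr v; apply/val_inj.
Qed.

End ClosedField.

(** * Morphisms of Zariski spaces *)

Local Open Scope classical_set_scope.

Local Notation yvar k := ('X_(@Ordinal 3 k isT)).
Local Notation xvar k := ('X_(@Ordinal 4 k isT)).
Local Notation ycoord y k := (tnth (val y) (@Ordinal 3 k isT)).
Local Notation xcoord x k := (tnth (val x) (@Ordinal 4 k isT)).

Lemma open_local (T : topologicalType) (O : set T) :
  (forall x, O x -> exists W : set T, [/\ open W, W x & W `<=` O]) -> open O.
Proof.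
move=> H; rewrite openE => x Ox; have [W [oW Wx WO]] := H x Ox.
by apply: (filterS WO); apply: open_nbhs_nbhs.
Qed.

Section Spaces.
Variable K : closedFieldType.
Implicit Types S T X : space_with_functions K.

Lemma regular_eq S (U : set S) (f g : S -> K) : open U ->
  (forall x, U x -> f x = g x) -> regular U f -> regular U g.
Proof.
move=> oU E rf; apply: regular_local => // x Ux.
by exists U, f; split=> // y /E.
Qed.

Lemma regular_meval S (U : set S) n (p : {mpoly K[n]}) (f : 'I_n -> S -> K) :
  open U -> (forall i, regular U (f i)) -> regular U (fun x => p.@[f^~ x]).
Proof.
move=> oU rf; elim/mpoly_gen_ind: p => [c|i|p q rp rq|p q rp rq].
- by apply: (regular_eq oU _ (regular_cst c oU)) => x _; rewrite mevalC.
- by apply: (regular_eq oU _ (rf i)) => x _; rewrite mevalXU.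
- by apply: (regular_eq oU _ (regular_add oU rp rq)) => x _; rewrite mevalD.
- by apply: (regular_eq oU _ (regular_mul oU rp rq)) => x _; rewrite mevalM.
Qed.

Lemma regular_sub S (U : set S) (f g : S -> K) : open U ->
  regular U f -> regular U g -> regular U (fun x => f x - g x).
Proof.
move=> oU rf rg; apply: (regular_add (f := f) (g := fun x => - g x)) => //.
apply: (regular_eq oU _ (regular_mul oU (regular_cst (-1) oU) rg)) => x _.
by rewrite mulN1r.
Qed.

Lemma morphism_on_comp S T X (U : set S) (W : set T) (F : S -> T) (G : T -> X) :
  morphism_on U F -> morphism_on W G -> U `<=` F @^-1` W -> morphism_on U (G \o F).
Proof.
move=> mF mG sUW V oV; have [oGV rG] := mG V oV; have [oF rF] := mF _ oGV.
have <- : U `&` F @^-1` (W `&` G @^-1` V) = U `&` (G \o F) @^-1` V.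
  by apply/seteqP; split=> x [Ux] => [[]|Vx] //; split=> //; split=> //; apply: sUW.
by split=> // g rg; apply: (rF _ (rG g rg)).
Qed.

Lemma morphism_on_open S T (U : set S) (F : S -> T) : morphism_on U F -> open U.
Proof. by move=> /(_ setT openT)[]; rewrite preimage_setT setIT. Qed.

Lemma morphism_on_local S T (U : set S) (F : S -> T) :
  (forall x, U x -> exists (W : set S) (G : S -> T),
     [/\ W x, W `<=` U, morphism_on W G & forall y, W y -> F y = G y]) ->
  morphism_on U F.
Proof.
move=> H V oV.
have H' x : (U `&` F @^-1` V) x -> exists (W : set S) (G : S -> T),
    [/\ open W, W x, W `<=` U `&` F @^-1` V,
    forall g : T -> K, regular V g -> regular W (g \o G) & forall y, W y -> F y = G y].
  move=> [Ux Vx]; have [W [G [Wx sW mG FG]]] := H x Ux.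
  have [oW rG] := mG V oV.
  exists (W `&` G @^-1` V), G; split=> //.
  - by split=> //; rewrite /= -FG.
  - by move=> y [Wy] /=; rewrite -FG // => Vy; split=> //; apply: sW.
  - by move=> y [Wy _]; apply: FG.
have oUV : open (U `&` F @^-1` V).
  by apply: open_local => x /H'[W [G [? ? ? _ _]]]; exists W; split.
split=> // g rg; apply: regular_local => // x /H'[W [G [oW Wx sW rG FG]]].
exists W, (g \o G); split=> //; first exact: rG.
by move=> y /FG /= ->.
Qed.

Lemma morphism_on_subset S T (U W : set S) (F : S -> T) :
  open W -> W `<=` U -> morphism_on U F -> morphism_on W F.
Proof.
move=> oW sWU mF V oV; have [oV' rV] := mF V oV.
have -> : W `&` F @^-1` V = W `&` (U `&` F @^-1` V).
  by rewrite setIA (setIidl sWU).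
split; first exact: openI.
move=> g /rV; apply: regular_restr => //; first exact: openI.
Qed.

Lemma open_immersion_morphism S T (c : S -> T) : open_immersion c -> morphism_on setT c.
Proof.
move=> [inj oR oE rE] V oV.
have oVR : open (V `&` range c) by apply: openI.
have E : c @^-1` (V `&` range c) = c @^-1` V.
  by apply/seteqP; split=> x => [[]|Vx] //; split=> //; exists x.
rewrite setTI; split.
  apply/oE; rewrite (_ : _ @` _ = V `&` range c) //.
  apply/seteqP; split=> [_ [x Vx <-]|y [Vy [x _ Exy]]]; first by split=> //; exists x.
  by exists x => //=; rewrite Exy.
move=> g rg; rewrite -E; apply/rE => //.
by apply: (regular_restr oV) rg => //; apply: subIsetl.
Qed.

Lemma open_immersion_of_inverse S T (c : S -> T) (d : T -> S) :
  morphism_on setT c -> morphism_on (range c) d -> cancel c d -> open_immersion c.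
Proof.
move=> mc md cK; have oR := morphism_on_open md.
have im W : c @` W = range c `&` d @^-1` W.
  apply/seteqP; split=> [_ [x Wx <-]|_ [[x _ <-]]] /=; first by split;
    [exists x|rewrite cK].
  by rewrite cK => Wx; exists x.
split=> //; first exact: can_inj cK.
  move=> W; split=> [oW|/mc[]]; first by rewrite im; apply: (md _ oW).1.
  rewrite setTI (_ : c @^-1` _ = W) //; apply/seteqP; split=> x /=; last by exists x.
  by move=> [y Wy /(can_inj cK) <-].
move=> W g oW sW; have [oc rc] := mc W oW; rewrite setTI in oc rc.
split=> [/rc //|rg].
have [o r] := md _ oc.
have E : range c `&` d @^-1` (c @^-1` W) = W.
  apply/seteqP; split=> [_ [[x _ <-]] /=|y Wy]; first by rewrite cK.
  by split; [exact: sW|have [x _ Ex] := sW y Wy; move: Wy; rewrite -Ex /= cK].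
have := r _ rg; rewrite E => r'; apply: (regular_eq oW _ r') => y /sW[x _ <-] /=.
by rewrite cK.
Qed.

End Spaces.

Section ZariskiClosed.
Variables (K : closedFieldType).

Lemma zariski_closedI n (A B : set (n.-tuple K)) :
  zariski_closed A -> zariski_closed B -> zariski_closed (A `&` B).
Proof.
move=> [S ->] [S' ->]; exists (S `|` S'); apply/seteqP; split=> x.
  by move=> [H1 H2] p []; [apply: H1|apply: H2].
by move=> H; split=> p Sp; apply: H; [left|right].
Qed.

Lemma zariski_closed_comp n m (A : set (n.-tuple K)) (lq : n.-tuple {mpoly K[m]}) :
  zariski_closed A ->
  zariski_closed [set u : m.-tuple K | A [tuple (tnth lq i).@[tnth u] | i < n]].
Proof.
move=> [S ->]; exists [set p \mPo lq | p in S]; apply/seteqP; split=> u /= H.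
  move=> _ [p Sp <-]; rewrite comp_mpoly_meval -[RHS](H p Sp).
  by apply: meval_eq => i; rewrite tnth_mktuple.
move=> p Sp; rewrite -[RHS](H _ (ex_intro2 _ _ p Sp erefl)) comp_mpoly_meval.
by apply: meval_eq => i; rewrite tnth_mktuple.
Qed.

End ZariskiClosed.

(** * Regular functions and morphisms on subsets of affine space *)

Section ZariskiSpace.
Variables (K : closedFieldType) (n : nat) (V : set (n.-tuple K)).
Local Notation Z := (zariski_space V).

Definition zpoint (x : n.-tuple K) (Vx : V x) : Z := exist _ x (mem_set Vx).

Lemma zpoint_valP (x : Z) : V (val x).
Proof. by case: x => x /= /set_mem. Qed.

Definition basic_open (h : {mpoly K[n]}) : set Z :=
  [set x : Z | h.@[tnth (val x)] != 0].

Lemma open_basic_open h : open (basic_open h).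
Proof.
exists (zero_locus [set h]); first by eexists.
apply/seteqP; split=> x /=; first by move=> hx /(_ h erefl)/eqP; rewrite (negPf hx).
by move=> H; apply/eqP => hx; apply: H => p ->.
Qed.

Lemma open_basicP (U : set Z) x : open U -> U x ->
  exists2 h, basic_open h x & basic_open h `<=` U.
Proof.
move=> [_ [S ->] ->] /= H.
have [h [Sh hx]] : exists h, S h /\ h.@[tnth (val x)] != 0.
  apply: contrapT => nH; apply: H => p Sp; apply/eqP; apply: contrapT => /negP px.
  by apply: nH; exists p.
by exists h => // y /eqP hy /(_ h Sh).
Qed.

Lemma regular_frac (U : set Z) f : regular U f -> forall x, U x ->
  exists p q h : {mpoly K[n]}, [/\ basic_open h x, basic_open h `<=` U &
    forall y, basic_open h y -> q.@[tnth (val y)] != 0 /\ f y = p.@[tnth (val y)]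
      / q.@[tnth (val y)]].
Proof.
move=> rf x /rf[W [p [q [oW Wx WU E]]]].
have [h hx hW] := open_basicP oW Wx.
by exists p, q, h; split=> // [y /hW/WU//|y /hW/E].
Qed.

Lemma regular_poly (U : set Z) (p : {mpoly K[n]}) :
  open U -> regular U (fun x : Z => p.@[tnth (val x)]).
Proof.
move=> oU x Ux; exists U, p, 1; split=> // y _.
by rewrite meval1 oner_neq0 divr1.
Qed.

Lemma regular_coord (U : set Z) i : open U -> regular U (fun x : Z => tnth (val x) i).
Proof.
move=> oU; apply: (regular_eq oU _ (regular_poly 'X_i oU)) => x _.
by rewrite mevalXU.
Qed.

Lemma open_regular_neq0 (U : set Z) f : regular U f -> open (U `&` [set x | f x != 0]).
Proof.
move=> rf; apply: open_local => x [Ux fx].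
have [p [q [h [hx hU E]]]] := regular_frac rf Ux.
exists (basic_open (h * p)); split; first exact: open_basic_open.
  have [q0 Ef] := E x hx; rewrite /basic_open /= mevalM mulf_neq0 //.
  by apply: contraNneq fx => p0; rewrite Ef p0 mul0r.
move=> y; rewrite /basic_open /= mevalM mulf_eq0 negb_or => /andP[hy py].
by have [q0 ->] := E y hy; split; [exact: hU|rewrite mulf_neq0 ?invr_neq0].
Qed.

Lemma regular_inv (U : set Z) f : regular U f -> (forall x, U x -> f x != 0) ->
  regular U (fun x => (f x)^-1).
Proof.
move=> rf f0 x Ux; have [p [q [h [hx hU E]]]] := regular_frac rf Ux.
exists (basic_open h), q, p; split=> //; first exact: open_basic_open.
move=> y hy; have [q0 Ey] := E y hy; split; last by rewrite Ey invf_div.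
by have := f0 y (hU y hy); rewrite Ey mulf_eq0 negb_or => /andP[].
Qed.

Lemma regular_div (U : set Z) f g : open U -> regular U f -> regular U g ->
  (forall x, U x -> g x != 0) -> regular U (fun x => f x / g x).
Proof. by move=> oU rf rg g0; apply: (regular_mul (f := f)) => //;
  apply: regular_inv. Qed.

End ZariskiSpace.

Arguments basic_open {K n} V h.
Arguments open_basic_open {K n} V h.

Section ZariskiMorphism.
Variables (K : closedFieldType) (n m : nat).
Variables (V : set (n.-tuple K)) (W : set (m.-tuple K)).

(** Polynomials in the coordinates of [F] are regular, so preimages of principal open sets are open,
    and quotients of polynomials pull back to regular functions. *)
Lemma morphism_on_coord (U : set (zariski_space V)) (F : zariski_space V ->
  zariski_space W) :
  open U -> (forall i, regular U (fun x => tnth (val (F x)) i)) -> morphism_on U F.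
Proof.
move=> oU rF.
have rp (p : {mpoly K[m]}) : regular U (fun x => p.@[tnth (val (F x))]).
  exact: (regular_meval p oU rF).
move=> O oO; have oF : open (U `&` F @^-1` O).
  apply: open_local => x [Ux Ox]; have [h hx hO] := open_basicP oO Ox.
  exists (U `&` [set y | h.@[tnth (val (F y))] != 0]); split=> //.
    exact: (open_regular_neq0 (rp h)).
  by move=> y [Uy hy]; split=> //; apply: hO.
split=> // g rg; apply: regular_local => // x [Ux Ox].
have [p [q [h [hx hO E]]]] := regular_frac rg Ox.
have oN : open (U `&` [set y | h.@[tnth (val (F y))] != 0]) := open_regular_neq0 (rp h).
exists (U `&` [set y | h.@[tnth (val (F y))] != 0]),
  (fun y => p.@[tnth (val (F y))] / q.@[tnth (val (F y))]); split=> //.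
- by move=> y [Uy hy]; split=> //; apply: hO.
- apply: regular_div => //.
  + by apply: (regular_restr oU oN _ (rp p)); apply: subIsetl.
  + by apply: (regular_restr oU oN _ (rp q)); apply: subIsetl.
  + by move=> y [_ /E[]].
- by move=> y [_ /E[_ Ey]] /=; rewrite Ey.
Qed.

Lemma morphism_coord (U : set (zariski_space V)) (F : zariski_space V ->
  zariski_space W) i :
  morphism_on U F -> regular U (fun x => tnth (val (F x)) i).
Proof.
move=> mF; have [_ /(_ _ (regular_coord i openT))] := mF setT openT.
by rewrite preimage_setT setIT.
Qed.

End ZariskiMorphism.

(** * Separatedness, density and principal open subsets *)

Section Separation.
Variable K : closedFieldType.

Lemma chart_coord (X : space_with_functions K) n (V : set (n.-tuple K))
    (c : zariski_space V -> X) : open_immersion c ->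
  exists g : 'I_n -> X -> K, forall i,
    regular (range c) (g i) /\ forall v, g i (c v) = tnth (val v) i.
Proof.
move=> oc; have [inj oR _ rE] := oc.
(* Chart coordinates, extended by 0 outside the range of [c]. *)
pose g i x := if pselect (exists v, c v = x) is left e
  then tnth (val (projT1 (cid e))) i else 0.
have gc i v : g i (c v) = tnth (val v) i.
  rewrite /g; case: pselect => [e|[]]; last by exists v.
  by case: (cid e) => w /= /inj ->.
exists g => i; split; last exact: gc.
apply/rE => //.
have -> : c @^-1` range c = setT by apply/seteqP; split=> // x _; exists x.
by apply: (regular_eq openT _ (regular_coord i openT)) => v _ /=; rewrite gc.
Qed.

Lemma prevariety_chart (X : space_with_functions K) (x : X) : is_prevariety X ->
  exists n (V : set (n.-tuple K)) (c : zariski_space V -> X),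
    affine_chart c /\ range c x.
Proof.
move=> [N [U [aff cov]]].
have [i _ Uix] : (\bigcup_i U i) x by rewrite cov.
have [n [V [c [ac Ec]]]] := aff i; exists n, V, c; split=> //.
by rewrite Ec.
Qed.

(** In the product of a chart around [F x] and one around [G x] the diagonal is closed, by
    separatedness. Some equation of it fails at [(F x, G x)], and this failure is an open condition
    on the point. *)
Lemma open_neq_morphisms n (V : set (n.-tuple K)) (T : space_with_functions K)
    (U : set (zariski_space V)) (F G : zariski_space V -> T) :
  is_variety T -> morphism_on U F -> morphism_on U G ->
  open (U `&` [set x | F x <> G x]).
Proof.
move=> [pT sepT] mF mG; have oU := morphism_on_open mF.
apply: open_local => x [Ux Nx].
have [k [A [c [[Ac oc] [v0 _ Ev0]]]]] := prevariety_chart (F x) pT.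
have [l [B [d [[Bd od] [w0 _ Ew0]]]]] := prevariety_chart (G x) pT.
have [S ES] := sepT _ _ _ _ _ _ (conj Ac oc) (conj Bd od).
have [gc gcP] := chart_coord oc; have [gd gdP] := chart_coord od.
have [injc oRc _ _] := oc; have [injd oRd _ _] := od.
have [oF rF] := mF _ oRc; have [oG rG] := mG _ oRd.
set NF := U `&` _ in oF rF; set NG := U `&` _ in oG rG.
pose u (y : zariski_space V) (i : 'I_(k + l)) := match fintype.split i with
  inl a => gc a (F y) | inr b => gd b (G y) end.
have oN : open (NF `&` NG) by apply: openI.
have ru i : regular (NF `&` NG) (fun y => u y i).
  rewrite /u; case: (fintype.split i) => j.
    by apply: (regular_restr oF oN _ (rF _ (gcP j).1)); apply: subIsetl.
  by apply: (regular_restr oG oN _ (rG _ (gdP j).1)); apply: subIsetr.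
have uE y (v : zariski_space A) (w : zariski_space B) : F y = c v -> G y = d w ->
    u y =1 tnth [tuple of val v ++ val w].
  move=> Fy Gy i; rewrite /u -[in RHS](splitK i); case: (fintype.split i) => j /=.
    by rewrite tnth_lshift Fy (gcP j).2.
  by rewrite tnth_rshift Gy (gdP j).2.
have [p [Sp px]] : exists p, S p /\ p.@[u x] != 0.
  apply: contrapT => H.
  have : zero_locus S [tuple of val v0 ++ val w0].
    move=> p Sp; apply: contrapT => /eqP px; apply: H; exists p; split=> //.
    by rewrite (meval_eq (v2 := tnth [tuple of val v0 ++ val w0])) //; apply: uE.
  rewrite -ES => -[v [w [E /= cd]]]; apply: Nx; rewrite -Ev0 -Ew0.
  suff [-> ->] : v0 = v /\ w0 = w by [].
  by split; apply/val_inj/eq_from_tnth => i;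
    [have := congr1 (fun t => tnth t (lshift l i)) E;
    rewrite !tnth_lshift|have := congr1 (fun t => tnth t (rshift k i)) E;
    rewrite !tnth_rshift].
have rp : regular (NF `&` NG) (fun y => p.@[u y]) := regular_meval p oN ru.
exists ((NF `&` NG) `&` [set y | p.@[u y] != 0]); split.
- exact: (open_regular_neq0 rp).
- by split=> //; split; split=> //=; [exists v0|exists w0].
move=> y [[[Uy [v _ Fy]] [_ [w _ Gy]]] /= py]; split=> // FG.
move/eqP: py; apply; rewrite (meval_eq (v2 := tnth [tuple of val v ++ val w]));
  last exact: uE.
have : [set t | exists (v1 : zariski_space A) (w1 : zariski_space B),
    t = [tuple of val v1 ++ val w1] /\ [set p0 : T * T | p0.1 = p0.2] (c v1, d w1)]
      [tuple of val v ++ val w].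
  by exists v, w; split=> //=; rewrite Fy Gy.
by rewrite ES => /(_ p Sp).
Qed.

(** Irreducibility of affine space: if [U] contains the principal open set of [h], a point where
    [h * e * r] does not vanish lies in [V], in [U] and off the zeros of [r]. *)
Lemma basic_open_meet n (V : set (n.-tuple K)) (e r : {mpoly K[n]}) (U : set
  (zariski_space V)) x :
  (forall x, e.@[tnth x] != 0 -> V x) -> e != 0 -> r != 0 -> open U -> U x ->
  exists y, U y /\ r.@[tnth (val y)] != 0.
Proof.
move=> eV e0 r0 oU Ux; have [h hx hU] := open_basicP oU Ux.
have h0 : h != 0 by apply: contraNneq hx => ->; rewrite meval0.
have [y] := mpoly_nonroot (mulf_neq0 (mulf_neq0 h0 e0) r0).
rewrite !mevalM !mulf_eq0 !negb_or => /andP[/andP[hy ey] ry].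
by exists (zpoint (eV y ey)); split=> //; apply: hU.
Qed.

(** By separatedness the locus of disagreement is open; if nonempty, it would contain a point where
    [r] does not vanish. *)
Lemma morphisms_eq_dense n (V : set (n.-tuple K)) (e r : {mpoly K[n]})
    (T : space_with_functions K) (U : set (zariski_space V)) (F G : zariski_space V
      -> T) :
  (forall x, e.@[tnth x] != 0 -> V x) -> e != 0 -> r != 0 ->
  is_variety T -> morphism_on U F -> morphism_on U G ->
  (forall x, U x -> r.@[tnth (val x)] != 0 -> F x = G x) ->
  forall x, U x -> F x = G x.
Proof.
move=> eV e0 r0 vT mF mG E x Ux; apply: contrapT => Nx.
have oN := open_neq_morphisms vT mF mG.
have [y [[Uy Ny] ry]] := basic_open_meet eV e0 r0 oN (conj Ux Nx).
by apply: Ny; apply: E.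
Qed.

(** On the closed set [P], the product of [A] and [B], the locus where [c \o pr1] and [d \o pr2]
    coincide is closed, because the coordinates of these morphisms are regular functions. *)
Lemma quasi_affine_separated n (V : set (n.-tuple K)) : is_separated (zariski_space V).
Proof.
move=> k l A B c d [Ac oc] [Bd od].
pose lq1 : k.-tuple {mpoly K[k + l]} := [tuple 'X_(lshift l i) | i < k].
pose lq2 : l.-tuple {mpoly K[k + l]} := [tuple 'X_(rshift k i) | i < l].
pose q1 (u : (k + l).-tuple K) := [tuple (tnth lq1 i).@[tnth u] | i < k].
pose q2 (u : (k + l).-tuple K) := [tuple (tnth lq2 i).@[tnth u] | i < l].
pose P := [set u | A (q1 u)] `&` [set u | B (q2 u)].
have cP : zariski_closed P by apply: zariski_closedI; apply: zariski_closed_comp.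
pose pr1 (u : zariski_space P) : zariski_space A :=
  @zpoint _ _ A (q1 (val u)) (zpoint_valP u).1.
pose pr2 (u : zariski_space P) : zariski_space B :=
  @zpoint _ _ B (q2 (val u)) (zpoint_valP u).2.
have m1 : morphism_on setT pr1.
  apply: morphism_on_coord openT _ => i.
  apply: (regular_eq openT _ (regular_coord (lshift l i) openT)) => u _ /=.
  by rewrite !tnth_mktuple mevalXU.
have m2 : morphism_on setT pr2.
  apply: morphism_on_coord openT _ => i.
  apply: (regular_eq openT _ (regular_coord (rshift k i) openT)) => u _ /=.
  by rewrite !tnth_mktuple mevalXU.
have mc : morphism_on setT (c \o pr1) :=
  morphism_on_comp m1 (open_immersion_morphism oc) (fun _ _ => I).
have md : morphism_on setT (d \o pr2) :=
  morphism_on_comp m2 (open_immersion_morphism od) (fun _ _ => I).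
have [D cD ED] : open [set u | c (pr1 u) <> d (pr2 u)].
  apply: open_local => u Nu.
  have [i ni] : exists i, tnth (val (c (pr1 u))) i != tnth (val (d (pr2 u))) i.
    apply: contrapT => H; apply: Nu; apply/val_inj/eq_from_tnth => i; apply/eqP.
    by apply: contrapT => /negP ni; apply: H; exists i.
  have r := regular_sub openT (morphism_coord i mc) (morphism_coord i md).
  eexists; split; first exact: (open_regular_neq0 r).
    by split=> //=; rewrite subr_eq0.
  by move=> y [_ /=]; rewrite subr_eq0 => ny E; move: ny; rewrite E eqxx.
have -> : [set u : (k + l).-tuple K | exists (v : zariski_space A) (w :
  zariski_space B),
   u = [tuple of val v ++ val w] /\ [set p | p.1 = p.2] (c v, d w)] = P `&` D.
  have cl (v : k.-tuple K) (w : l.-tuple K) : q1 [tuple of v ++ w]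
    = v /\ q2 [tuple of v ++ w] = w.
    by split; apply: eq_from_tnth => i;
      rewrite !tnth_mktuple mevalXU ?tnth_lshift ?tnth_rshift.
  have eqD (u : zariski_space P) : (D (val u)) <-> c (pr1 u) = d (pr2 u).
    have := congr1 (@^~ u) ED; rewrite /= => E; split=> [Du|e].
      by apply: contrapT; rewrite E.
    by apply: contrapT; rewrite -E; apply.
  apply/seteqP; split=> [_ [v [w [-> /= cd]]]|u [Pu Du]].
    have [E1 E2] := cl (val v) (val w).
    have Pvw : P [tuple of val v ++ val w].
      by split; rewrite /= ?E1 ?E2; apply: zpoint_valP.
    split=> //; apply: (eqD (zpoint Pvw)).2.
    suff [-> ->] : pr1 (zpoint Pvw) = v /\ pr2 (zpoint Pvw) = w by [].
    by split; apply/val_inj.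
  exists (pr1 (zpoint Pu)), (pr2 (zpoint Pu)); split; last exact: (eqD (zpoint Pu)).1.
  apply: eq_from_tnth => i; rewrite -(splitK i); case: (fintype.split i) => j /=.
    by rewrite tnth_lshift /= !tnth_mktuple mevalXU.
  by rewrite tnth_rshift /= !tnth_mktuple mevalXU.
exact: zariski_closedI.
Qed.

(** Rabinowitsch's trick: the principal open set of [r] is isomorphic to the hypersurface
    [r * t = 1] in one more variable [t]. *)
Lemma affine_basic_open n (V : set (n.-tuple K)) (r : {mpoly K[n]}) :
  r != 0 -> (forall x, r.@[tnth x] != 0 -> V x) ->
  affine_open (basic_open V r).
Proof.
move=> r0 rV.
pose w (i : 'I_n) := widen_ord (leqnSn n) i.
pose q (u : n.+1.-tuple K) := [tuple tnth u (w i) | i < n].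
pose Vr := [set u : n.+1.-tuple K | r.@[tnth (q u)] * tnth u ord_max = 1].
have cVr : zariski_closed Vr.
  exists [set (r \mPo [tuple 'X_(w i) | i < n]) * 'X_ord_max - 1].
  have E u : ((r \mPo [tuple 'X_(w i) | i < n]) * 'X_ord_max - 1).@[tnth u]
    = r.@[tnth (q u)] * tnth u ord_max - 1.
    rewrite mevalB mevalM meval1 mevalXU comp_mpoly_meval; congr (_ * _ - _).
    by apply: meval_eq => i; rewrite !tnth_mktuple mevalXU.
  apply/seteqP; split=> u /=; first by move=> Eu _ ->; rewrite E Eu subrr.
  by move=> /(_ _ erefl); rewrite E => /eqP; rewrite subr_eq0 => /eqP.
have nz u : Vr u -> r.@[tnth (q u)] != 0.
  by move=> E; apply: contra_eq_neq E => ->; rewrite mul0r eq_sym oner_neq0.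
pose c (u : zariski_space Vr) : zariski_space V := zpoint (rV _ (nz _ (zpoint_valP u))).
pose t (x : n.-tuple K) : n.+1.-tuple K :=
  [tuple if insub (val i) is Some j then tnth x j else (r.@[tnth x])^-1 | i < n.+1].
have tw x i : tnth (t x) (w i) = tnth x i.
  rewrite tnth_mktuple insubT //= => h; congr tnth; exact/val_inj.
have tm x : tnth (t x) ord_max = (r.@[tnth x])^-1.
  by rewrite tnth_mktuple insubF //= ltnn.
have qt x : q (t x) = x by apply: eq_from_tnth => i; rewrite tnth_mktuple tw.
have Vt x : r.@[tnth x] != 0 -> Vr (t x) by move=> rx; rewrite /Vr /= qt tm mulfV.
(* The point [x0] provides the value of the total function [d] at the zeros of [r]. *)
have [x0 rx0] := mpoly_nonroot r0.
pose d (x : zariski_space V) : zariski_space Vr :=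
  if pselect (r.@[tnth (val x)] != 0) is left rx then zpoint (Vt _ rx) else zpoint
    (Vt _ rx0).
have dE x : r.@[tnth (val x)] != 0 -> val (d x) = t (val x).
  by rewrite /d; case: pselect.
have cK : cancel c d.
  move=> u; apply/val_inj; rewrite dE; last exact: nz (zpoint_valP u).
  apply: eq_from_tnth => i; have [->|[j ->]] := ord_max_or_widen i.
    rewrite tm; have E := zpoint_valP u; rewrite /= in E.
    by apply: (mulfI (nz _ E)); rewrite [RHS]E mulfV // nz.
  by rewrite tw /= tnth_mktuple.
have Ec : range c = basic_open V r.
  apply/seteqP; split=> [_ [u _ <-]|x rx]; first exact: nz (zpoint_valP u).
  exists (d x) => //; apply/val_inj; rewrite /= dE //.
exists n.+1, Vr, c; split=> //; split=> //.
apply: (open_immersion_of_inverse _ _ cK).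
  apply: morphism_on_coord openT _ => i.
  apply: (regular_eq openT _ (regular_coord (w i) openT)) => u _ /=.
  by rewrite tnth_mktuple.
have ob := open_basic_open V r.
rewrite Ec; apply: morphism_on_coord => // i; have [->|[j ->]] := ord_max_or_widen i.
  have /(@regular_eq _ _ _ _ _ ob) : regular (basic_open V r) (fun x =>
    (r.@[tnth (val x)])^-1).
    by apply: regular_inv => //; apply: regular_poly.
  by apply=> x rx; rewrite dE // tm.
apply: (regular_eq ob _ (regular_coord j ob)) => x rx.
by rewrite dE // tw.
Qed.

Lemma quasi_affine_variety n (V : set (n.-tuple K)) N (r : 'I_N -> {mpoly K[n]}) :
  (forall i, r i != 0) -> (forall i x, (r i).@[tnth x] != 0 -> V x) ->
  (forall x, V x -> exists i, (r i).@[tnth x] != 0) -> is_variety (zariski_space V).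
Proof.
move=> r0 rV cov; split; last exact: quasi_affine_separated.
exists N, (fun i => basic_open V (r i)); split.
  by move=> i; apply: affine_basic_open => //; apply: rV.
by apply/seteqP; split=> // x _; have [i hi] := cov _ (zpoint_valP x); exists i.
Qed.

End Separation.

(** * Denominators in lowest terms *)

Section Eval.
Variable K : closedFieldType.

Lemma mpoly_ext n (p q : {mpoly K[n]}) :
  (forall x : n.-tuple K, p.@[tnth x] = q.@[tnth x]) -> p = q.
Proof.
move=> H; apply/eqP; rewrite -subr_eq0; apply: contraT => /mpoly_nonroot[x].
by rewrite mevalB H subrr eqxx.
Qed.

Lemma mpoly_eq_generic n (r p q : {mpoly K[n]}) : r != 0 ->
  (forall x : n.-tuple K, r.@[tnth x] != 0 -> p.@[tnth x] = q.@[tnth x]) -> p = q.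
Proof.
move=> r0 H; apply: (mulfI r0); apply: mpoly_ext => x; rewrite !mevalM.
by have [->|/H ->] := eqVneq r.@[tnth x] 0; rewrite ?mul0r.
Qed.

Lemma mpoly_neq0 n (p : {mpoly K[n]}) x : p.@[x] != 0 -> p != 0.
Proof. by apply: contraNneq => ->; rewrite meval0. Qed.

Lemma meval_comp3 n (p : {mpoly K[3]}) (a b c : {mpoly K[n]}) v :
  (p \mPo [tuple a; b; c]).@[v] = p.@[tnth [tuple a.@[v]; b.@[v]; c.@[v]]].
Proof.
by rewrite comp_mpoly_meval; apply: meval_eq; case=> [[|[|[]]]].
Qed.

Lemma meval_comp4 n (p : {mpoly K[4]}) (a b c d : {mpoly K[n]}) v :
  (p \mPo [tuple a; b; c; d]).@[v] = p.@[tnth [tuple a.@[v]; b.@[v]; c.@[v]; d.@[v]]].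
Proof.
by rewrite comp_mpoly_meval; apply: meval_eq; case=> [[|[|[|[]]]]].
Qed.

Lemma tuple3P (x : 3.-tuple K) : exists a b c, x = [tuple a; b; c].
Proof.
case: x => [[|a [|b [|c []]]] //= H]; exists a, b, c; exact/val_inj.
Qed.

Lemma tuple4P (x : 4.-tuple K) : exists a b c d, x = [tuple a; b; c; d].
Proof.
case: x => [[|a [|b [|c [|d []]]]] //= H]; exists a, b, c, d; exact/val_inj.
Qed.

End Eval.

Section Denominator.
Variable K : closedFieldType.
Implicit Types (p q r A B : {mpoly K[3]}) (P Q : {mpoly K[4]}).

(* The blow-up chart [(s, u, c) |-> (s, u s, c)] of the line [y1 = y2 = 0], and
   the slice [x1 = 1] that lifts it to [C^4]. *)
Let blowup p : {mpoly K[3]} := p \mPo [tuple yvar 0; yvar 1 * yvar 0; yvar 2].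
Let slice P : {mpoly K[3]} := P \mPo [tuple 1; yvar 1; yvar 2; yvar 0].
(** Restriction to the exceptional divisor [s = 0] of the blow-up chart. *)
Let restr0 p : {mpoly K[3]} := p \mPo [tuple 0; yvar 1; yvar 2].

(** On the slice, [x1 = 1], [x3 = c] and [x4 = s] are polynomials in [(s, u s, c)], and [x2 = u]
    becomes one after multiplication by [s]; a power of [s] therefore clears all denominators. *)
Lemma slice_blowup P : exists N q, blowup q = yvar 0 ^+ N * slice P.
Proof.
rewrite /blowup /slice; elim/mpoly_gen_ind: P =>
  [c|i|P Q [N [p Ep]] [M [q Eq]]|P Q [N [p Ep]] [M [q Eq]]].
- by exists 0%N, c%:MP; rewrite !comp_mpolyC mul1r.
- case: i => [[|[|[|[|]]]] h] //.
  + exists 0%N, 1; rewrite comp_mpoly1 comp_mpolyXU /= mul1r //.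
  + exists 1%N, (yvar 1); rewrite !comp_mpolyXU /= mulrC //.
  + exists 0%N, (yvar 2); rewrite !comp_mpolyXU /= mul1r //.
  + exists 0%N, (yvar 0); rewrite !comp_mpolyXU /= mul1r //.
- exists (N + M)%N, (yvar 0 ^+ M * p + yvar 0 ^+ N * q).
  rewrite !comp_mpolyD !rmorphM !rmorphXn /= !comp_mpolyXU /= Ep Eq exprD; ring.
- exists (N + M)%N, (p * q).
  rewrite !rmorphM /= Ep Eq exprD; ring.
Qed.

Lemma restr0_dvd p : exists r, p = restr0 p + (yvar 0) * r.
Proof.
rewrite /restr0; elim/mpoly_gen_ind: p => [c|i|p q [r Ep] [s Eq]|p q [r Ep] [s Eq]].
- by exists 0; rewrite comp_mpolyC mulr0 addr0.
- case: i => [[|[|[|]]] h] //.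
  + exists 1; rewrite comp_mpolyXU /= mulr1 add0r; congr 'X_ _; exact/val_inj.
  + exists 0; rewrite comp_mpolyXU /= mulr0 addr0; congr 'X_ _; exact/val_inj.
  + exists 0; rewrite comp_mpolyXU /= mulr0 addr0; congr 'X_ _; exact/val_inj.
- exists (r + s); rewrite comp_mpolyD {1}Ep {1}Eq; ring.
- exists (r * (q \mPo [tuple 0; yvar 1; yvar 2]) + (p \mPo [tuple 0; yvar 1;
    yvar 2]) * s + (yvar 0) * r * s).
  rewrite rmorphM /= {1}Ep {1}Eq; ring.
Qed.

Lemma Y0_neq0 : (yvar 0) != 0 :> {mpoly K[3]}.
Proof. by apply: (@mpoly_neq0 _ _ _ (fun=> 1)); rewrite mevalXU oner_neq0. Qed.

(** The kernel of [restr0] consists of the multiples of [s] and is prime, so [s] can be cancelled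
    one power at a time. *)
Lemma restr0_cancel N A r B : restr0 B != 0 -> yvar 0 ^+ N * A = r * B ->
  exists s, A = s * B.
Proof.
move=> B0; elim: N r => [|N IH] r E; first by exists r; rewrite -E mul1r.
have : restr0 r * restr0 B = 0.
  rewrite /restr0 -rmorphM -E !rmorphM rmorphXn /= comp_mpolyXU /=.
  by rewrite exprS !mul0r.
move/eqP; rewrite mulf_eq0 (negPf B0) orbF => /eqP r0.
have [s Es] := restr0_dvd r; rewrite r0 add0r in Es.
apply: (IH s); apply: (mulfI Y0_neq0).
by rewrite mulrA -exprS E Es mulrA.
Qed.

Lemma denominator_neq0 p q P Q c0 :
  (forall d z, divides d (z * p) -> divides d (z * q) -> divides d z) ->
  q.@[tnth [tuple 0; 0; c0]] != 0 ->
  P * (q \mPo [tuple xvar 0 * xvar 3; xvar 1 * xvar 3; xvar 2]) =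
  Q * (p \mPo [tuple xvar 0 * xvar 3; xvar 1 * xvar 3; xvar 2]) ->
  Q.@[tnth [tuple 1; 1; 0; 0]] != 0 -> q.@[tnth [tuple 0; 0; 0]] != 0.
Proof.
move=> cop qc E Q0.
have [N [P2 EP]] := slice_blowup P; have [M [Q2 EQ]] := slice_blowup Q.
(* A point [(s, u, c)] with [s != 0] is the image of [(s, u / s, c)] under the blow-up chart, so [E]
   on the slice descends, after clearing powers of [s], to a polynomial identity on the base. *)
have E2 : (yvar 0 ^+ M * P2) * q = (yvar 0 ^+ N * Q2) * p.
  apply: (mpoly_eq_generic Y0_neq0) => x; have [s [u [c ->]]] := tuple3P x.
  rewrite mevalXU /= => s0.
  pose v := tnth [tuple s; u / s; c].
  have bl (f : {mpoly K[3]}) : f.@[tnth [tuple s; u; c]] = (blowup f).@[v].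
    by rewrite meval_comp3 mevalM !mevalXU /v /= divfK.
  have sl (F : {mpoly K[4]}) : (slice F).@[v] = F.@[tnth [tuple 1; u / s; c; s]].
    by rewrite meval_comp4 !mevalXU meval1.
  have := congr1 (fun F => F.@[tnth [tuple 1; u / s; c; s]]) E.
  rewrite !mevalM !meval_comp3 !mevalM !mevalXU /= !mul1r divfK // => E'.
  rewrite (bl P2) (bl Q2) EP EQ !mevalM !sl.
  rewrite !rmorphXn /= !mevalXU /v /=.
  set a := _.@[_] in E' *; set b := q.@[_] in E' *; set c' := Q.@[_] in E' *;
    set d := p.@[_] in E' *.
  have -> : s ^+ M * (s ^+ N * a) * b = s ^+ M * s ^+ N * (a * b) by ring.
  by rewrite E'; ring.
have [r Er] : divides q (yvar 0 ^+ N * Q2).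
  apply: cop; last by exists (yvar 0 ^+ N * Q2).
  by exists (yvar 0 ^+ M * P2); rewrite E2.
have E3 : yvar 0 ^+ (N + M) * slice Q = blowup r * blowup q.
  rewrite /blowup -rmorphM -Er rmorphM rmorphXn /= comp_mpolyXU /= -/(blowup Q2) EQ.
  by rewrite exprD mulrA.
(* On [s = 0], [blowup q] restricts to [q (0, 0, c)], which is nonzero at [c = c0]. *)
have B0 : restr0 (blowup q) != 0.
  apply: (@mpoly_neq0 _ _ _ (tnth [tuple 0; 0; c0])).
  by rewrite !meval_comp3 meval0 mevalM !mevalXU /= mulr0.
have [s Es] := restr0_cancel B0 E3.
(* The chart point [(0, 1, 0)] maps to the origin under the blow-up and to [(1, 1, 0, 0)] on the
   slice. *)
have := congr1 (meval (tnth [tuple 0; 1; 0])) Es.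
rewrite mevalM meval_comp4 meval_comp3 mevalM meval1 !mevalXU /= mulr0 => EE.
by apply: contraNneq Q0 => q0; rewrite EE q0 mulr0.
Qed.

End Denominator.

(** * The quotient *)

Section PolyMap.
Variables (K : closedFieldType) (n m : nat).
Variables (V : set (n.-tuple K)) (W : set (m.-tuple K)).

Lemma morphism_on_poly (U : set (zariski_space V)) (F : zariski_space V ->
  zariski_space W)
    (lq : m.-tuple {mpoly K[n]}) : open U ->
  (forall x, U x -> val (F x) = [tuple of map (meval (tnth (val x))) lq]) ->
  morphism_on U F.
Proof.
move=> oU E; apply: morphism_on_coord => // i.
apply: (regular_eq oU _ (regular_poly (tnth lq i) oU)) => x Ux.
by rewrite E // tnth_map.
Qed.

End PolyMap.

(* [exX_set R] and [ex_pi_fun] are convertible to the instances of [unionX] and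
   [pi_map] at the field [R[i]]. *)
Definition unionX (K : closedFieldType) : set (4.-tuple K) :=
  [set x : 4.-tuple K | (x`_2 != 0 /\ x`_3 != 0) \/ (x`_0 != 0 /\ x`_1 != 0)].

Section Example.
Variable K : closedFieldType.
Local Notation C := K.
Local Notation xset := (@unionX K).
Local Notation X := (zariski_space xset).
Local Notation A3 := (affine_space K 3).

Definition pi_map (x : X) : A3 :=
  let x := val x in
  exist _ [tuple x`_0 * x`_3; x`_1 * x`_3; x`_2] (in_setT _).

Lemma unionX_default : xset [tuple 1; 1; 1; 1].
Proof. by left; rewrite /= oner_neq0. Qed.

(** Made total by sending tuples outside [X] to [(1, 1, 1, 1)]. *)
Definition ptX (t : 4.-tuple C) : X :=
  if pselect (xset t) is left h then zpoint h else zpoint unionX_default.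

Lemma ptXE t : xset t -> val (ptX t) = t.
Proof. by rewrite /ptX; case: pselect. Qed.

Lemma ptX_val (x : X) : ptX (val x) = x.
Proof. by apply/val_inj; rewrite ptXE //; apply: zpoint_valP. Qed.

Lemma unionXP (x : X) : exists a b c d, xset [tuple a; b; c;
  d] /\ x = ptX [tuple a; b; c; d].
Proof.
have [a [b [c [d E]]]] := tuple4P (val x); exists a, b, c, d.
by rewrite -E ptX_val; split=> //; apply: zpoint_valP.
Qed.

Definition ptA (t : 3.-tuple C) : A3 := @zpoint C 3 setT t I.

Lemma ptA_val (y : A3) : ptA (val y) = y.
Proof. exact/val_inj. Qed.

Lemma pi_map_ptX a b c d : xset [tuple a; b; c; d] ->
  pi_map (ptX [tuple a; b; c; d]) = ptA [tuple a * d; b * d; c].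
Proof. by move=> h; apply/val_inj; rewrite /= ptXE. Qed.

Definition dense_poly : {mpoly C[4]} := xvar 2 * xvar 3.

Lemma dense_polyP x : dense_poly.@[tnth x] != 0 -> xset x.
Proof.
have [a [b [c [d ->]]]] := tuple4P x.
by rewrite mevalM !mevalXU /= mulf_eq0 negb_or => /andP[? ?]; left.
Qed.

Lemma mvar_neq0 n (i : 'I_n) : 'X_i != 0 :> {mpoly C[n]}.
Proof. by apply: (@mpoly_neq0 _ _ _ (fun=> 1)); rewrite mevalXU oner_neq0. Qed.

Lemma dense_poly_neq0 : dense_poly != 0.
Proof. by rewrite mulf_neq0 ?mvar_neq0. Qed.

Lemma unionX_variety : is_variety X.
Proof.
apply: (@quasi_affine_variety _ _ _ 2
  (fun i => if i == ord0 then dense_poly else xvar 0 * xvar 1)).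
- by move=> i; case: ifP => _; rewrite ?dense_poly_neq0 // mulf_neq0 ?mvar_neq0.
- move=> i x; case: ifP => _; first exact: dense_polyP.
  have [a [b [c [d ->]]]] := tuple4P x.
  by rewrite mevalM !mevalXU /= mulf_eq0 negb_or => /andP[? ?]; right.
- move=> x; have [a [b [c [d ->]]]] := tuple4P x.
  case=> -[/= n1 n2]; [exists ord0|exists ord_max];
    by rewrite /= mevalM !mevalXU /= mulf_neq0.
Qed.

Lemma A3_variety : is_variety A3.
Proof.
apply: (@quasi_affine_variety _ _ _ 1 (fun=> 1)) => // [_|x _].
  exact: oner_neq0.
by exists ord0; rewrite meval1 oner_neq0.
Qed.

Lemma unionX_dc_subset : is_dc_subset [set: X].
Proof.
split; first exact: unionX_variety.
  by move=> O [x Ox] _; exists x.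
exists 1%N, (fun=> setT), (fun=> setT); split.
- by move=> _; apply: openT.
- by move=> _; apply: closedT.
- by apply/seteqP; split=> // x _; exists ord0.
Qed.

Definition pi_section (y : A3) : X := ptX [tuple ycoord y 0; ycoord y 1; ycoord y 2; 1].

(** The points [y] for which [(y1, y2, y3, 1)] lies in [X], so that [pi_section] is a genuine
    section there. *)
Definition section_dom : set A3 :=
  basic_open setT (yvar 2) `|` basic_open setT (yvar 0 * yvar 1).

Lemma section_ptA a b c : pi_section (ptA [tuple a; b; c]) = ptX [tuple a; b; c; 1].
Proof. by []. Qed.

Lemma A3P (y : A3) : exists a b c, y = ptA [tuple a; b; c].
Proof.
have [a [b [c E]]] := tuple3P (val y); exists a, b, c.
by rewrite -E ptA_val.
Qed.

Lemma section_domP a b c : section_dom (ptA [tuple a; b;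
  c]) <-> c != 0 \/ (a != 0 /\ b != 0).
Proof.
rewrite /section_dom /basic_open /setU /= mevalM !mevalXU /= mulf_eq0 negb_or.
by split=> [[H|/andP H]|[H|/andP H]]; by [left|right].
Qed.

Lemma section_unionX a b c : c != 0 \/ (a != 0 /\ b != 0) -> xset [tuple a; b; c; 1].
Proof. by case=> H; [left; rewrite /= oner_neq0|right]. Qed.

Lemma pi_mapK y : section_dom y -> pi_map (pi_section y) = y.
Proof.
have [a [b [c ->]]] := A3P y => /section_domP/section_unionX h.
by rewrite section_ptA pi_map_ptX // !mulr1.
Qed.

(** A point of [X] lies over [section_dom] unless [x3 = x4 = 0], in which case it maps to the
    origin. *)
Lemma range_pi_mapP y : range pi_map y <-> section_dom y \/ y = ptA [tuple 0; 0; 0].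
Proof.
split=> [[x _ <-]|[/pi_mapK E|->]]; last 2 first.
- by exists (pi_section y).
- have h : xset [tuple 1; 1; 0; 0] by right; rewrite /= oner_neq0.
  by exists (ptX [tuple 1; 1; 0; 0]); rewrite ?pi_map_ptX // !mulr0.
have [a [b [c [d [h ->]]]]] := unionXP x; rewrite pi_map_ptX //.
have [->|d0] := eqVneq d 0.
  rewrite !mulr0; have [->|c0] := eqVneq c 0; [by right|left].
  by apply/section_domP; left.
left; apply/section_domP; case: h => -[/= ? ?]; [by left|right].
by rewrite !mulf_neq0.
Qed.

Lemma open_section_dom : open section_dom.
Proof. by apply: openU; apply: open_basic_open. Qed.

Lemma range_pi_map_dc_subset : is_dc_subset (range pi_map).
Proof.
split; first exact: A3_variety.
  move=> O [x Ox] oO.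
  have [y [Oy y2]] := @basic_open_meet _ _ setT 1 (yvar 2) O x (fun _ _ =>
    I) (oner_neq0 _) (mvar_neq0 _) oO Ox.
  by exists y; split=> //; apply/range_pi_mapP; left; left.
(* Two locally closed pieces: the open set [section_dom], and the origin as the common zero set of
   the coordinates. *)
pose U (i : 'I_2) : set A3 := if i == ord0 then section_dom else setT.
pose F (i : 'I_2) : set A3 := if i == ord0 then setT else ~` (basic_open setT (yvar
  0) `|` basic_open setT (yvar 1) `|` basic_open setT (yvar 2)).
exists 2%N, U, F; split.
- by move=> i; rewrite /U; case: ifP => _; [exact: open_section_dom|exact: openT].
- move=> i; rewrite /F; case: ifP => _; first exact: closedT.
  by apply: open_closedC; apply: openU; [apply: openU|]; apply: open_basic_open.
apply/seteqP; split=> y.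
  move=> /range_pi_mapP[?|->]; first by exists ord0.
  exists ord_max => //; split=> //; rewrite /F /= /basic_open /= /setU /=.
  by rewrite !mevalXU => -[[]|] /eqP; apply.
move=> [i _]; rewrite /U /F; case: ifP => _ [H1 H2]; apply/range_pi_mapP; first by left.
right; move: H2; have [a [b [c ->]]] := A3P y.
rewrite /= /basic_open /= /setU /= !mevalXU /= => H.
suff [-> [-> ->]] : a = 0 /\ b = 0 /\ c = 0 by [].
by split; [|split]; apply/eqP; apply: contraT => n0; exfalso; apply: H; tauto.
Qed.

Lemma pi_map_morphism : morphism_on setT pi_map.
Proof.
apply: (morphism_on_poly (lq := [tuple xvar 0 * xvar 3; xvar 1 * xvar 3;
  xvar 2])) => [|x _]; first exact: openT.
apply/val_inj => /=; rewrite !mevalM !mevalXU /=.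
by rewrite !(tnth_nth 0).
Qed.

(** * Invariant morphisms are constant on the fibres of [pi_map] *)

Section Quotient.
Variables (Z : space_with_functions C) (Phi : X -> Z).
Hypotheses (vZ : is_variety Z) (mPhi : morphism_on setT Phi).
Hypothesis inv : forall (t : K) (x y : X), t != 0 ->
  val y = [tuple t * (val x)`_0; t * (val x)`_1; (val x)`_2; t^-1 * (val x)`_3] ->
  Phi y = Phi x.

Definition sigma (x : X) : X := pi_section (pi_map x).

(** The torus element [t = x4] moves [x] to [(x1 x4, x2 x4, x3, 1) = sigma x]. *)
Lemma Phi_sigma4 (x : X) : xcoord x 3 != 0 -> Phi x = Phi (sigma x).
Proof.
have [a [b [c [d [h ->]]]]] := unionXP x; rewrite ptXE // /= => d0.
have h' : xset [tuple a * d; b * d; c; 1].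
  by apply: section_unionX; case: h => -[/= ? ?]; [left|right]; rewrite ?mulf_neq0.
have dV0 : d^-1 != 0 by rewrite invr_eq0.
rewrite /sigma pi_map_ptX // section_ptA.
apply: (inv dV0); rewrite !ptXE //=; apply/val_inj => /=.
by rewrite mulr1 invrK !(mulrC d^-1) !mulfK.
Qed.

Lemma sigma_morphism3 : morphism_on (basic_open xset (xvar 2)) sigma.
Proof.
apply: (morphism_on_poly (lq := [tuple xvar 0 * xvar 3; xvar 1 * xvar 3; xvar 2;
  1])); first exact: open_basic_open.
move=> x; have [a [b [c [d [h ->]]]]] := unionXP x.
rewrite /basic_open /= mevalXU ptXE //= => c0.
rewrite /sigma pi_map_ptX // section_ptA ptXE; last by apply: section_unionX; left.
by apply/val_inj; rewrite /= meval1 !mevalM !mevalXU.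
Qed.

(** Both sides are morphisms on [x3 != 0] and agree on the dense subset [x4 != 0]; separatedness
    extends the equality to [x4 = 0]. *)
Lemma Phi_sigma3 (x : X) : xcoord x 2 != 0 -> Phi x = Phi (sigma x).
Proof.
move=> x2; apply: (morphisms_eq_dense dense_polyP dense_poly_neq0 (mvar_neq0
  (@Ordinal 4 3 isT)) vZ (U := basic_open xset (xvar 2)) (F := Phi) (G :=
  Phi \o sigma)).
- by apply: morphism_on_subset mPhi => //; apply: open_basic_open.
- exact: (morphism_on_comp sigma_morphism3 mPhi).
- by move=> y _; rewrite mevalXU; apply: Phi_sigma4.
- by rewrite /basic_open /= mevalXU.
Qed.

(* A point over the origin. *)
Definition x_origin : X := ptX [tuple 1; 1; 0; 0].

Lemma x_origin_unionX : xset [tuple 1; 1; 0; 0].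
Proof. by right; rewrite /= oner_neq0. Qed.

(** Compare [(x1, x2, x3, 0)] with [(1, 1, x3, 0)] on [x1 x2 != 0]. For [x3 != 0] both lie over
    [(0, 0, x3)], so [Phi] agrees on them by [Phi_sigma3]; by density it also agrees at [x3 = 0]. *)
Lemma Phi_axis a b : a != 0 -> b != 0 -> Phi (ptX [tuple a; b; 0; 0]) = Phi x_origin.
Proof.
move=> a0 b0.
pose U := basic_open xset (xvar 0 * xvar 1).
pose F (x : X) : X := ptX [tuple xcoord x 0; xcoord x 1; xcoord x 2; 0].
pose G (x : X) : X := ptX [tuple 1; 1; xcoord x 2; 0].
have oU : open U := open_basic_open _ _.
have UP x : U x -> xcoord x 0 != 0 /\ xcoord x 1 != 0.
  by rewrite /U /basic_open /= mevalM !mevalXU mulf_eq0 negb_or => /andP.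
have FE x : U x -> val (F x) = [tuple xcoord x 0; xcoord x 1; xcoord x 2; 0].
  by move=> /UP H; apply: ptXE; right.
have GE x : val (G x) = [tuple 1; 1; xcoord x 2; 0].
  by apply: ptXE; right; rewrite /= oner_neq0.
have mF : morphism_on U F.
  apply: (morphism_on_poly (lq := [tuple xvar 0; xvar 1; xvar 2; 0]) oU) => x Ux.
  by rewrite FE //; apply/val_inj; rewrite /= meval0 !mevalXU.
have mG : morphism_on U G.
  apply: (morphism_on_poly (lq := [tuple 1; 1; xvar 2; 0]) oU) => x Ux.
  by rewrite GE //; apply/val_inj; rewrite /= meval0 meval1 !mevalXU.
have hab : xset [tuple a; b; 0; 0] by right.
have := @morphisms_eq_dense _ _ xset dense_poly (xvar 2) Z U (Phi \o F) (Phi \o G)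
  dense_polyP dense_poly_neq0 (mvar_neq0 _) vZ (morphism_on_comp mF mPhi (fun _ _
  => I)) (morphism_on_comp mG mPhi (fun _ _ => I)).
move=> H; have := H _ (ptX [tuple a; b; 0; 0]).
rewrite /= /F /G /x_origin ptXE //=; apply; last first.
  by rewrite /U /basic_open /= ptXE // mevalM !mevalXU mulf_neq0.
move=> x Ux; rewrite mevalXU => x2; have [x0 x1] := UP _ Ux.
have piF : pi_map (F x) = ptA [tuple 0; 0; xcoord x 2].
  by apply/val_inj; rewrite /= FE //; apply/val_inj; rewrite /= !mulr0.
have piG : pi_map (G x) = ptA [tuple 0; 0; xcoord x 2].
  by apply/val_inj; rewrite /= GE //; apply/val_inj; rewrite /= !mulr0.
by rewrite /= [LHS]Phi_sigma3 ?FE // [RHS]Phi_sigma3 ?GE // /sigma piF piG.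
Qed.

(** The second branch is meant for the origin, the one point of the image of [pi_map] outside
    [section_dom]. *)
Definition psi (y : A3) : Z := if pselect (section_dom y) then Phi (pi_section y)
  else Phi x_origin.

Lemma psi_section y : section_dom y -> psi y = Phi (pi_section y).
Proof. by rewrite /psi; case: pselect. Qed.

Lemma psi0 : psi (ptA [tuple 0; 0; 0]) = Phi x_origin.
Proof.
by rewrite /psi; case: pselect => // h; have := (section_domP 0 0 0).1 h;
  rewrite !eqxx => -[|[]].
Qed.

Lemma psi_pi x : psi (pi_map x) = Phi x.
Proof.
have Y : section_dom (pi_map x) \/ pi_map x = ptA [tuple 0; 0; 0].
  by apply: (range_pi_mapP _).1; exists x.
case: Y => [h|Ey].
  rewrite psi_section //; have [a [b [c [d [hx Ex]]]]] := unionXP x.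
  have [c0|c0] := eqVneq c 0; last by rewrite -/(sigma x) -Phi_sigma3 // Ex ptXE.
  rewrite -/(sigma x) -Phi_sigma4 // Ex ptXE //=.
  move: h; rewrite Ex pi_map_ptX // => /section_domP; rewrite c0 eqxx => -[//|[]].
  by rewrite mulf_eq0 negb_or => /andP[].
rewrite Ey psi0; have [a [b [c [d [hx Ex]]]]] := unionXP x.
move: Ey; rewrite Ex pi_map_ptX // => /(congr1 val)/(congr1 val)/= [ad bd c0].
(* Over the origin, [x3 = 0] forces [x1] and [x2] to be nonzero, hence [x4 = 0], and [Phi_axis]
   applies. *)
move: hx ad bd Ex; rewrite {}c0 => -[[/eqP//]|[/= a0 b0]] /eqP.
rewrite mulf_eq0 (negPf a0) /= => /eqP -> _ _.
by rewrite Phi_axis.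
Qed.

End Quotient.
End Example.

(** * Extension of [psi] across the origin *)

Section Extension.
Variable K : closedFieldType.
Local Notation C := K.
Local Notation xset := (@unionX K).
Local Notation X := (zariski_space xset).
Local Notation A3 := (affine_space K 3).

(** An expression of [F] near [(0, 0, c0, 1)], restricted to [x4 = 1] and put in lowest terms
    [p / q], is compared through [sigma] with an expression [P / Q] near [x_origin];
    [denominator_neq0] then gives that [q] does not vanish at the origin. The polynomial [r] marks a
    dense open set on which [p / q] represents [F] along the section. *)
Lemma invariant_frac (O : set X) (F : X -> C) (c0 : C) :
  regular O F -> O (x_origin K) -> O (ptX [tuple 0; 0; c0; 1]) -> c0 != 0 ->
  (forall x : X, xcoord x 2 != 0 -> F x = F (sigma x)) ->
  exists p q r : {mpoly C[3]}, [/\ q.@[tnth [tuple 0; 0; 0]] != 0, r != 0,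
    F (x_origin K) = p.@[tnth [tuple 0; 0; 0]] / q.@[tnth [tuple 0; 0; 0]] &
    forall t, r.@[tnth t] != 0 -> F (pi_section (ptA t)) = p.@[tnth t] / q.@[tnth t]].
Proof.
move=> rF O0 O1 c00 inv.
have [P [Q [hA [A0 _ AF]]]] := regular_frac rF O0.
have [p1 [q1 [hB [B0 _ BF]]]] := regular_frac rF O1.
pose lift (f : {mpoly C[4]}) : {mpoly C[3]} := f \mPo [tuple yvar 0; yvar 1; yvar 2; 1].
have liftE f a b c : (lift f).@[tnth [tuple a; b; c]] = f.@[tnth [tuple a; b; c; 1]].
  by rewrite meval_comp4 !mevalXU meval1.
have [g [p [q [Ep Eq cop]]]] := gcd_domain_mpoly (lift p1) (lift q1).
have s1 : xset [tuple 0; 0; c0; 1] by apply: section_unionX; left.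
have vx_origin : val (x_origin K) = [tuple 1; 1; 0; 0] by apply: ptXE;
  apply: x_origin_unionX.
have [Q0 F0] := AF _ A0.
have [q10 _] := BF _ B0.
rewrite /basic_open /= vx_origin in A0 Q0 F0; rewrite /basic_open /= ptXE // in B0 q10.
have qc0 : q.@[tnth [tuple 0; 0; c0]] != 0.
  by move: q10; rewrite -liftE Eq mevalM mulf_eq0 negb_or => /andP[].
have Fsection t : (lift hB * yvar 2).@[tnth t] != 0 ->
    q.@[tnth t] != 0 /\ F (pi_section (ptA t)) = p.@[tnth t] / q.@[tnth t].
  have [a [b [c ->]]] := tuple3P t.
  rewrite mevalM mevalXU liftE mulf_eq0 negb_or => /andP[hb c1].
  have hs : xset [tuple a; b; c; 1] by apply: section_unionX; left.
  have vs : val (pi_section (ptA [tuple a; b; c])) = [tuple a; b; c;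
    1] by rewrite section_ptA ptXE.
  have := BF (pi_section (ptA [tuple a; b; c]));
    rewrite /basic_open /= vs => /(_ hb)[n1 ->].
  move: n1; rewrite -!liftE Ep Eq !mevalM mulf_eq0 negb_or => /andP[g0 q0].
  by split=> //; rewrite -mulf_div divff // mul1r.
pose pi3 (f : {mpoly C[3]}) : {mpoly C[4]} := f \mPo [tuple xvar 0 * xvar 3;
  xvar 1 * xvar 3; xvar 2].
have piE f a b c d : (pi3 f).@[tnth [tuple a; b; c; d]] = f.@[tnth [tuple a * d;
  b * d; c]].
  by rewrite meval_comp3 !mevalM !mevalXU.
have hB0 : lift hB * yvar 2 != 0.
  apply: (@mpoly_neq0 _ _ _ (tnth [tuple 0; 0; c0])).
  by rewrite mevalM liftE mevalXU mulf_neq0.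
(* Both fractions represent [F] where [hA], [pi3 (lift hB)], [x3] and [x4] do not vanish; equality
   there gives an identity of polynomials. *)
have E : P * pi3 q = Q * pi3 p.
  have hAB : hA * (pi3 (lift hB * yvar 2) * xvar 3) != 0.
    rewrite !mulf_neq0 ?mvar_neq0 //; first exact: mpoly_neq0 A0.
    apply: (@mpoly_neq0 _ _ _ (tnth [tuple 0; 0; c0; 1])).
    by rewrite piE !mul0r mevalM liftE mevalXU mulf_neq0.
  apply: (mpoly_eq_generic hAB) => x; have [a [b [c [d ->]]]] := tuple4P x.
  rewrite !mevalM !piE mevalXU !mulf_eq0 !negb_or => /and3P[ha hb d0].
  have [q0 Fq] := Fsection _ hb.
  move: hb; rewrite mevalM mevalXU mulf_eq0 negb_or => /andP[_ cn0].
  have hx : xset [tuple a; b; c; d] by left.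
  have vx : val (ptX [tuple a; b; c; d]) = [tuple a; b; c; d] := ptXE hx.
  have := AF (ptX [tuple a; b; c; d]); rewrite /basic_open /= vx => /(_ ha)[n1].
  rewrite inv ?vx // /sigma pi_map_ptX // Fq => /eqP.
  by rewrite eqr_div // => /eqP; rewrite mulrC => <-; rewrite mulrC.
have q00 : q.@[tnth [tuple 0; 0; 0]] != 0 by apply: (denominator_neq0 cop qc0 E).
exists p, q, (lift hB * yvar 2); split=> //; last by move=> t /Fsection[].
rewrite F0; have := congr1 (meval (tnth [tuple 1; 1; 0; 0])) E.
rewrite !mevalM !piE !mulr0 => E0.
by apply/eqP; rewrite eqr_div //; apply/eqP; rewrite E0 mulrC.
Qed.

Lemma pi_section_morphism : morphism_on (@section_dom K) (@pi_section K).
Proof.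
apply: (morphism_on_poly (lq := [tuple yvar 0; yvar 1; yvar 2; 1]));
  first exact: open_section_dom.
move=> y; have [a [b [c ->]]] := A3P y => /section_domP/section_unionX h.
by rewrite section_ptA ptXE //; apply/val_inj; rewrite /= meval1 !mevalXU.
Qed.

Section Quotient.
Variables (Z : space_with_functions C) (Phi : X -> Z).
Hypotheses (vZ : is_variety Z) (mPhi : morphism_on setT Phi).
Hypothesis inv : forall (t : K) (x y : X), t != 0 ->
  val y = [tuple t * (val x)`_0; t * (val x)`_1; (val x)`_2; t^-1 * (val x)`_3] ->
  Phi y = Phi x.

(** In an affine chart [c] of [Z] around the value of [Phi] at [x_origin], [invariant_frac] turns
    each chart coordinate of [Phi] into a fraction regular near the origin; these are the
    coordinates of the extension. *)
Lemma psi_extension0 : exists (h : {mpoly C[3]}) (F : A3 -> Z),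
  [/\ h.@[tnth [tuple 0; 0; 0]] != 0, morphism_on (basic_open setT h) F,
    forall y, basic_open setT h y -> section_dom y -> F y = psi Phi y &
    F (ptA [tuple 0; 0; 0]) = psi Phi (ptA [tuple 0; 0; 0])].
Proof.
have sigma3 := Phi_sigma3 vZ mPhi inv.
have [n [W [c [[[S WE] oc] [v0 _ cv0]]]]] := prevariety_chart (Phi (x_origin K)) vZ.1.
have [gc gcP] := chart_coord oc; have [_ oRc _ _] := oc.
have [oO rO] := mPhi oRc; rewrite setTI in oO rO.
set O := Phi @^-1` _ in oO rO.
have O00 : O (x_origin K) by exists v0.
have [h0 h00 h0O] := open_basicP oO O00.
(* By openness some [(1, 1, c0, 0)] with [c0 != 0] lies in [O], and [Phi] takes the same value at
   [(0, 0, c0, 1)] by [Phi_sigma3]. *)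
have [c0 [c00 O1]] : exists c0 : C, c0 != 0 /\ O (ptX [tuple 0; 0; c0; 1]).
  have nz : (h0 \mPo [tuple 1; 1; yvar 2; 0]) * yvar 2 != 0.
    rewrite mulf_neq0 ?mvar_neq0 //; apply: (@mpoly_neq0 _ _ _ (tnth [tuple 0; 0; 0])).
    by move: h00; rewrite meval_comp4 mevalXU meval1 meval0 /basic_open /= ptXE //;
      apply: x_origin_unionX.
  have [t] := mpoly_nonroot nz.
  rewrite mevalM meval_comp4 !mevalXU meval1 meval0 mulf_eq0 negb_or.
  set c0 := tnth t _ => /andP[h1 c00]; exists c0; split=> //.
  have hx : @unionX K [tuple 1; 1; c0; 0] by right; rewrite /= oner_neq0.
  have : O (ptX [tuple 1; 1; c0; 0]) by apply: h0O; rewrite /basic_open /= ptXE.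
  rewrite /O /= sigma3 ?ptXE // /sigma pi_map_ptX // section_ptA.
  by rewrite !mulr0.
have frac i := invariant_frac (rO _ (gcP i).1) O00 O1 c00 (fun x hx =>
  congr1 (gc i) (sigma3 x hx)).
have /choice[p /choice[q /choice[r H]]] := frac.
have [hO hO1 hOO] := open_basicP oO O1.
(* [h] collects the denominators; off the zeros of [rr] the fractions are the chart coordinates of
   [Phi \o pi_section]. *)
pose h := \prod_i q i.
pose rr := (hO \mPo [tuple yvar 0; yvar 1; yvar 2; 1]) * yvar 2 * \prod_i r i.
pose tt (y : A3) : n.-tuple C := [tuple (p i).@[tnth (val y)]
  / (q i).@[tnth (val y)] | i < n].
have s1 : @unionX K [tuple 0; 0; c0; 1] by apply: section_unionX; left.
have rr0 : rr != 0.
  rewrite mulf_neq0 //; last by apply/prodf_neq0 => i _; have [] := H i.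
  apply: (@mpoly_neq0 _ _ _ (tnth [tuple 0; 0; c0])).
  rewrite mevalM meval_comp4 !mevalXU meval1 mulf_neq0 //.
  by move: hO1; rewrite /basic_open /= ptXE.
have generic t : rr.@[tnth t] != 0 -> section_dom (ptA t) /\
    exists v, Phi (pi_section (ptA t)) = c v /\ tt (ptA t) = val v.
  rewrite !mevalM mevalXU !mulf_eq0 !negb_or => /andP[/andP[ht t2] rt].
  have d : section_dom (ptA t) by left; rewrite /basic_open /= mevalXU.
  split=> //.
  have [v _ cv] : O (pi_section (ptA t)).
    apply: hOO; move: ht d; have [a [b [e ->]]] := tuple3P t =>
      ht /section_domP/section_unionX hs.
    by move: ht; rewrite meval_comp4 !mevalXU meval1 /basic_open /= section_ptA ptXE.
  exists v; split=> //; apply: eq_from_tnth => i; rewrite tnth_mktuple.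
  rewrite -(gcP i).2 cv; have [_ _ _ E] := H i.
  apply/esym/E; move: rt.
  by rewrite rmorph_prod => /prodf_neq0; apply.
have oh : open (basic_open setT h) := open_basic_open _ _.
have q0 y i : basic_open setT h y -> (q i).@[tnth (val y)] != 0.
  by rewrite /basic_open /= rmorph_prod => /prodf_neq0; apply.
have rtt i : regular (basic_open setT h) (fun y =>
  (p i).@[tnth (val y)] / (q i).@[tnth (val y)]).
  by apply: regular_div => //; [apply: regular_poly|apply: regular_poly|move=> y /q0].
(* An equation of [W] that fails at [tt y] would fail on an open set, which contains a point off the
   zeros of [rr]; but there [tt] takes values in [W]. *)
have ttW y : basic_open setT h y -> W (tt y).
  move=> hy; rewrite WE => g Sg; apply: contrapT => /eqP gy.
  have rg : regular (basic_open setT h) (fun y => g.@[tnth (tt y)]).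
    apply: (regular_eq oh _ (regular_meval g oh rtt)) => z _.
    by apply: meval_eq => i; rewrite tnth_mktuple.
  have oN := open_regular_neq0 rg.
  have [z [[hz gz] rz]] := @basic_open_meet _ _ setT 1 rr _ y (fun _ _ =>
    Logic.I) (oner_neq0 _) rr0 oN (conj hy gy).
  have [_ [v [_ Ev]]] := generic _ rz; rewrite ptA_val in Ev.
  move/eqP: gz; apply; rewrite Ev.
  by have := zpoint_valP v; rewrite {1}WE; apply.
pose F0 (y : A3) : zariski_space W :=
  if pselect (W (tt y)) is left w then zpoint w else v0.
have F0E y : W (tt y) -> val (F0 y) = tt y by rewrite /F0; case: pselect.
have mF0 : morphism_on (basic_open setT h) F0.
  apply: morphism_on_coord => // i; apply: (regular_eq oh _ (rtt i)) => y hy.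
  by rewrite F0E ?tnth_mktuple //; apply: ttW.
have h0' : h.@[tnth [tuple 0; 0; 0]] != 0.
  by rewrite rmorph_prod; apply/prodf_neq0 => i _; have [] := H i.
have mF := morphism_on_comp mF0 (open_immersion_morphism oc) (fun _ _ => Logic.I).
exists h, (c \o F0); split=> //.
  (* On the overlap both are morphisms that agree off the zeros of [rr], hence everywhere by
     separatedness. *)
  move=> y hy dy; rewrite psi_section //.
  have oU : open (basic_open setT h `&` @section_dom K) by apply: openI => //;
    apply: open_section_dom.
  apply: (morphisms_eq_dense (V := setT) (e := 1) (r := rr) (F := c \o F0) (G :=
    Phi \o @pi_section K) _ (oner_neq0 _) rr0 vZ (U :=
    basic_open setT h `&` @section_dom K)) => //.
  - by apply: morphism_on_subset mF => //; apply: subIsetl.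
  - apply: morphism_on_subset (morphism_on_comp pi_section_morphism mPhi (fun _ _
      => Logic.I)) => //.
  move=> z [hz dz] rz; have [_ [v [Ev tv]]] := generic _ rz.
  rewrite ptA_val in Ev tv; rewrite /= Ev; congr c; apply/val_inj.
  by rewrite F0E -?tv //; apply: ttW.
rewrite psi0 -cv0 /=; congr c; apply/val_inj; rewrite F0E; last exact: ttW.
apply: eq_from_tnth => i; rewrite tnth_mktuple -(gcP i).2 cv0.
by have [_ _ E _] := H i; apply/esym/E.
Qed.

(** Glue [Phi \o pi_section] on [section_dom] with the morphism of [psi_extension0] near the origin:
    the two domains cover [Y], and the morphisms agree on the overlap. *)
Lemma psi_dc_extension : exists (U : set A3) (F : A3 -> Z),
  [/\ open U, range (@pi_map K) `<=` U, morphism_on U F & forall y, range (@pi_map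
    K) y -> F y = psi Phi y].
Proof.
have [h [F0 [h0 mF0 F0E F00]]] := psi_extension0.
have od : open (@section_dom K) := @open_section_dom K.
have oh : open (basic_open setT h) := open_basic_open _ _.
pose F (y : A3) := if pselect (section_dom y) then psi Phi y else F0 y.
have Fd y : section_dom y -> F y = Phi (pi_section y) by rewrite /F;
  case: pselect => // d _; rewrite psi_section.
have Fh y : basic_open setT h y -> F y = F0 y by rewrite /F;
  case: pselect => // d hy; rewrite F0E.
have h00 : basic_open setT h (ptA [tuple 0; 0; 0]) by [].
exists (@section_dom K `|` basic_open setT h), F; split.
- exact: openU.
- by move=> y /range_pi_mapP[d|->]; [left|right].
- apply: morphism_on_local => y [d|hy].
    exists (@section_dom K), (Phi \o @pi_section K); split; [exact: d|by move=> z;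
      left| |exact: Fd].
    exact: (morphism_on_comp pi_section_morphism mPhi (fun _ _ => Logic.I)).
  by exists (basic_open setT h), F0; split=> // z; right.
move=> y /range_pi_mapP[d|->]; first by rewrite Fd // psi_section.
by rewrite Fh.
Qed.

End Quotient.
End Extension.

(** * Verification of the universal property *)

Theorem mainTheorem1 (R : realType) :
  is_dc_categorical_quotient (@ex_act R) (@ex_pi R).
Proof.
split.
- exact: unionX_dc_subset.
- exact: range_pi_map_dc_subset.
- exists setT, (@ex_pi_fun R); split=> //; first exact: openT.
  exact: pi_map_morphism.
- move=> t x y E; apply/val_inj/val_inj/val_inj => /=; rewrite E /=.
  case: t E => t t0 _ /=.
  by congr [:: _; _; _]; rewrite mulrACA divff // mul1r.
move=> Z' Z phi [vZ _ _] [U [Phi [oU sU mU EPhi]]] invphi.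
have mPhi : morphism_on setT Phi.
  by apply: morphism_on_subset mU => //; apply: openT.
pose top (x : exX R) : [set: exX R] := exist _ x (mem_set Logic.I).
have topE (x : [set: exX R]) : top (val x) = x by apply/val_inj.
have inv (t : R[i]) (x y : exX R) : t != 0 -> val y = ex_act_fun t (val x) ->
  Phi y = Phi x.
  move=> t0 Ey; have := EPhi (top x); have := EPhi (top y); rewrite /= => -> ->.
  rewrite (invphi (exist (fun t : R[i] => t != 0) t t0) (top x) (top y)) //.
  exact/val_inj.
have psiZ (y : @exY R) : psi Phi (val y) \in Z.
  case: y => y /= /set_mem[x _ <-]; rewrite psi_pi //.
  by have := EPhi (top x); rewrite /= => ->; apply: valP.
pose Psi (y : @exY R) : Z := exist (fun z : Z' => z \in Z) _ (psiZ y).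
have pi_surj (y : @exY R) : exists x, y = ex_pi x.
  case: y => y hy; have [x _ Ex] := set_mem hy; exists (top x).
  by apply/val_inj; rewrite /= -Ex.
have PsiE : phi = Psi \o @ex_pi R.
  apply/funext => x; apply/val_inj; rewrite /= psi_pi //.
  by rewrite EPhi.
exists Psi; split; first split=> //.
  have [W [F [oW sW mW FE]]] := psi_dc_extension vZ mPhi inv.
  exists W, F; split=> // y; rewrite FE //.
  by case: y => y /= /set_mem.
(* Uniqueness: [Psi'] and [Psi] have the same composite with the surjection [ex_pi]. *)
move=> Psi' [_ E']; apply/funext => y; have [x ->] := pi_surj y.
by have := congr1 (@^~ x) PsiE; rewrite E' /= => <-.
Qed.
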